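(* Under the standing assumptions (A1)–(A5) in the context, there are constants $C_1,C_2,C_3>0$, depending only on $o_0,h_0,\zeta,q_0$, such that for every even $L$ and every nonzero integer $M$ with $|M|\le C_1\sqrt V$ there exists an energy eigenstate $|\Psi_L^M\rangle$ (an eigenvector of $\hat H_L$) with $\hat C_L|\Psi_L^M\rangle=(M_L+M)|\Psi_L^M\rangle$ whose energy eigenvalue $E_L^M$ satisfies $$E_L^{\rm gs}<E_L^M\le E_L^{\rm gs}+C_3\frac{|M|^3}{V}$$ in general, and $$E_L^{\rm gs}<E_L^M\le E_L^{\rm gs}+C_2\frac{M^2}{V}$$ if $M_L=0$.
   Context: Setting. Fix $d\ge1$. For even $L$ let $\Lambda_L=\{x\in\mathbb Z^d: -L/2<x_i\le L/2\}$ be the hypercubic lattice with periodic boundary conditions and $V=L^d$ sites. The Hilbert space is the tensor product over $x\in\Lambda_L$ of copies of a fixed finite-dimensional Hilbert space; an operator ''acts on'' a set of sites if it is the tensor product of an operator on those sites with the identity elsewhere. $\|\cdot\|$ is the operator norm. The Hamiltonian is $\hat H_L=\sum_{x\in\Lambda_L}\hat h_x$ (self-adjoint), with the $\hat h_x$ translational copies of each other. $E_L^{\rm gs}$ denotes the lowest eigenvalue of $\hat H_L$ and $|\Phi_L^{\rm gs}\rangle$ the normalized ground state. The constants $a,\zeta,h_0,o_0,q_0$ below do not depend on $L$. (A1) There is a self-adjoint $\hat C_L$ with $[\hat C_L,\hat h_x]=0$ for all $x$ (so $[\hat C_L,\hat H_L]=0$), and $-aV\le\hat C_L\le aV$ with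 a constant $a>0$. (A2) There are order operators $\hat{\mathcal O}_L^{(\alpha)}=\sum_{x\in\Lambda_L}\hat o_x^{(\alpha)}$, $\alpha=1,2$, with $\hat o_x^{(\alpha)}$ self-adjoint and translationally invariant (translational copies of each other, under suitable identifications of the single-site spaces), satisfying $[\hat{\mathcal O}_L^{(1)},\hat C_L]=-i\hat{\mathcal O}_L^{(2)}$, $[\hat{\mathcal O}_L^{(2)},\hat C_L]=i\hat{\mathcal O}_L^{(1)}$, $[\hat{\mathcal O}_L^{(1)},\hat{\mathcal O}_L^{(2)}]=i\hat C_L$. (A3) $\hat h_x$ acts on at most $\zeta$ sites including $x$; $\hat o_x^{(1)},\hat o_x^{(2)}$ act only on site $x$. Write $h_0=\|\hat h_x\|$ and $o_0=\|\hat o_x^{(1)}\pm i\hat o_x^{(2)}\|$, independent of $x$. (A4) For each $L$ the ground state $|\Phi_L^{\rm gs}\rangle$ of $\hat H_L$ is unique and $\hat C_L|\Phi_L^{\rm gs}\rangle=M_L|\Phi_L^{\rm gs}\rangle$ for some real $M_L$. (A5) There is a constant $q_0>0$ with $\langle\Phi_L^{\rm gs}|(\hat{\mathcal O}_L^{(1)}/V)^2|\Phi_L^{\rm gs}\rangle=\langle\Phi_L^{\rm gs}|(\hat{\mathcal O}_L^{(2)}/V)^2|\Phi_L^{\rm gs}\rangle\ge q_0$ for all $L$. *)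

(* Defs.v *)
From mathcomp Require Import all_boot all_order all_algebra.
From mathcomp Require Import all_classical all_reals complex.
Set Implicit Arguments.
Unset Strict Implicit.
Unset Printing Implicit Defensive.
Import Order.TTheory GRing.Theory Num.Theory.
Local Open Scope ring_scope.
Local Open Scope complex_scope.
Local Open Scope classical_set_scope.
Local Open Scope sesquilinear_scope.

(* Quantum systems on a finite set X of sites, each carrying a copy of C^n.
   The tensor product of the C^n over X has the orthonormal product basis
   indexed by the configurations {ffun X -> 'I_n}; kets and operators are
   column vectors and matrices in this basis, enumerated by enum_rank. *)
Section Operators.
Variable R : realType.

Definition config (X : finType) (n : nat) : finType := {ffun X -> 'I_n}.
Definition ket (X : finType) (n : nat) : Type := 'cV[R[i]]_#|config X n|.
Definition op (X : finType) (n : nat) : Type := 'M[R[i]]_#|config X n|.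

Definition braket m (u v : 'cV[R[i]]_m) : R[i] := (u^t* *m v) 0 0.
Definition expval m (v : 'cV[R[i]]_m) (A : 'M[R[i]]_m) : R[i] :=
  braket v (A *m v).
Definition vnorm m (v : 'cV[R[i]]_m) : R := Num.sqrt (complex.Re (braket v v)).
Definition opnorm m (A : 'M[R[i]]_m) : R :=
  sup [set r : R | exists2 v : 'cV[R[i]]_m, vnorm v <= 1 & r = vnorm (A *m v)].

(* The order on R[i] is the partial one: 0 <= z entails that z is real. *)
Definition op_le m (A B : 'M[R[i]]_m) : Prop :=
  forall v : 'cV[R[i]]_m, 0 <= expval v (B - A).

Definition selfadjoint m (A : 'M[R[i]]_m) : Prop := A^t* = A.
Definition unitary_op m (U : 'M[R[i]]_m) : Prop :=
  U^t* *m U = 1%:M /\ U *m U^t* = 1%:M.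
Definition commutator m (A B : 'M[R[i]]_m) : 'M[R[i]]_m := A *m B - B *m A.

Definition eigenvec m (A : 'M[R[i]]_m) (e : R) (v : 'cV[R[i]]_m) : Prop :=
  v != 0 /\ A *m v = e%:C *: v.

Definition lowest_eigenvalue m (A : 'M[R[i]]_m) (e : R) : Prop :=
  (exists v, eigenvec A e v) /\ (forall e' v, eigenvec A e' v -> e <= e').

Section Sites.
Variables (X : finType) (n : nat).

Definition op_of (f : config X n -> config X n -> R[i]) : op X n :=
  \matrix_(i, j) f (enum_val i) (enum_val j).

Definition entry (A : op X n) (s t : config X n) : R[i] :=
  A (enum_rank s) (enum_rank t).
End Sites.

(* B (x) 1, for B an operator on the sites of S. *)
Definition extend_op (X : finType) n (S : {set X})
    (B : op {x : X | x \in S} n) : op X n :=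
  let restrict (s : config X n) : config {x : X | x \in S} n :=
    [ffun x => s (val x)] in
  op_of (fun s t =>
    if [forall x, (x \notin S) ==> (s x == t x)]
    then entry B (restrict s) (restrict t) else 0).

Definition acts_on (X : finType) n (S : {set X}) (A : op X n) : Prop :=
  exists B : op {x : X | x \in S} n, A = extend_op B.

Definition tensor_op (X : finType) n (w : X -> 'M[R[i]]_n) : op X n :=
  op_of (fun s t => \prod_x w x (s x) (t x)).

End Operators.

(* The torus (Z/LZ)^d, for which {x : -L/2 < x_i <= L/2} is a set of
   representatives. Only meant for 1 < L, since 'Z_0 and 'Z_1 are Z/2Z. *)
Definition site (d L : nat) : finType := {ffun 'I_d -> 'Z_L}.

Definition shift d L n (t : site d L) (s : config (site d L) n) :
    config (site d L) n :=
  [ffun x : site d L => s ([ffun k => x k + t k] : site d L)].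

Section Translations.
Variables (R : realType) (d L n : nat).
Local Notation X := (site d L).

(* Conjugation by the unitary moving the content of each site x to x + t. *)
Definition translate (t : X) (A : op R X n) : op R X n :=
  op_of (fun r s => entry A (shift t r) (shift t s)).

Definition translational_copies (A : X -> op R X n) : Prop :=
  forall x t : X, A ([ffun k => x k + t k] : X) = translate t (A x).

(* Here the site x is identified with a reference copy of C^n through w x. *)
Definition translational_copies_under (w : X -> 'M[R[i]]_n)
    (A : X -> op R X n) : Prop :=
  translational_copies
    (fun x => (tensor_op w)^t* *m A x *m tensor_op w).
End Translations.

Record model (R : realType) (d n : nat) := Model {
  hloc : forall L, site d L -> op R (site d L) n;
  charge : forall L, op R (site d L) n;
  oloc1 : forall L, site d L -> op R (site d L) n;
  oloc2 : forall L, site d L -> op R (site d L) n;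
  Egs : nat -> R;
  gs : forall L, ket R (site d L) n;
  Mgs : nat -> R
}.

Section Assumptions.
Variables (R : realType) (d n : nat) (m : model R d n).

Definition volume (L : nat) : R := (L ^ d)%:R.

Definition hamiltonian (L : nat) : op R (site d L) n := \sum_x hloc m x.
Definition order1 (L : nat) : op R (site d L) n := \sum_x oloc1 m x.
Definition order2 (L : nat) : op R (site d L) n := \sum_x oloc2 m x.

Definition even_size (L : nat) : Prop := (0 < L)%N /\ ~~ odd L.

Definition hamiltonian_assumption (L : nat) : Prop :=
  selfadjoint (hamiltonian L) /\ translational_copies (@hloc _ _ _ m L).

Definition charge_assumption (a : R) (L : nat) : Prop :=
  [/\ selfadjoint (charge m L),
      forall x : site d L, commutator (charge m L) (hloc m x) = 0,
      op_le (- (a * volume L)%:C)%:M (charge m L) &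
      op_le (charge m L) ((a * volume L)%:C)%:M].

Definition order_assumption (L : nat) : Prop :=
  [/\ forall x : site d L, selfadjoint (oloc1 m x) /\ selfadjoint (oloc2 m x),
      exists w : site d L -> 'M[R[i]]_n,
        [/\ forall x, unitary_op (w x),
            translational_copies_under w (@oloc1 _ _ _ m L) &
            translational_copies_under w (@oloc2 _ _ _ m L)],
      commutator (order1 L) (charge m L) = - 'i%C *: order2 L,
      commutator (order2 L) (charge m L) = 'i%C *: order1 L &
      commutator (order1 L) (order2 L) = 'i%C *: charge m L].

Definition locality_assumption (o0 h0 : R) (zeta : nat) (L : nat) : Prop :=
  forall x : site d L,
    [/\ exists S : {set site d L},
          [/\ x \in S, (#|S| <= zeta)%N & acts_on S (hloc m x)],
        acts_on [set x]%SET (oloc1 m x) /\ acts_on [set x]%SET (oloc2 m x),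
        opnorm (hloc m x) = h0,
        opnorm (oloc1 m x + 'i%C *: oloc2 m x) = o0 &
        opnorm (oloc1 m x - 'i%C *: oloc2 m x) = o0].

Definition ground_state_assumption (L : nat) : Prop :=
  [/\ lowest_eigenvalue (hamiltonian L) (Egs m L),
      braket (gs m L) (gs m L) = 1,
      hamiltonian L *m gs m L = (Egs m L)%:C *: gs m L,
      forall v, hamiltonian L *m v = (Egs m L)%:C *: v ->
        exists c : R[i], v = c *: gs m L &
      charge m L *m gs m L = (Mgs m L)%:C *: gs m L].

Definition long_range_order_assumption (q0 : R) (L : nat) : Prop :=
  let density (O : op R (site d L) n) := (volume L)^-1%:C *: O in
  let O1 := density (order1 L) in
  let O2 := density (order2 L) in
  expval (gs m L) (O1 *m O1) = expval (gs m L) (O2 *m O2) /\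
  q0%:C <= expval (gs m L) (O2 *m O2).

Definition standing_assumptions (a o0 h0 : R) (zeta : nat) (q0 : R) : Prop :=
  forall L, even_size L ->
    [/\ hamiltonian_assumption L,
        charge_assumption a L,
        order_assumption L,
        locality_assumption o0 h0 zeta L &
        ground_state_assumption L /\ long_range_order_assumption q0 L].
End Assumptions.

(* Main.v *)
(* Write O+ and O- for the ladder operators O1 + i O2 and O1 - i O2, so that
   [O+, O-] = 2 C and [C, O+] = O+, and let Phi be the ground state. The trial
   state for charge M > 0 is Gamma = O+^M Phi (exchange O+ and O- and negate C
   when M < 0). Adding the nonnegative energy excess of O-^M Phi, the excess of
   Gamma is at most the double commutator <[O-^M, [H, O+^M]]>, which is a sum
   over the sites x of <[O-^M, [h_x, O+^M]]>.
   - Long-range order propagates up the tower: |O+^k Phi| / |O+^(k+1) Phi| is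
     at most tau = 1 / (sqrt q0 V) as long as M is at most C1 sqrt V.
   - Commuting O+ or O- with a local operator leaves it local, multiplies its
     norm by at most 2 zeta o0, and removes one ladder operator, which by the
     previous point is worth tau. Local operators can thus be moved to the
     middle of a word O-^c X O+^b, where Cauchy-Schwarz costs nothing more.
   - Reordering O+ and O- costs a charge of size |M_L| + M per swap but removes
     two ladder operators, which is worth tau^2.
   Summing up, the excess of Gamma is O(M^2 / V + M^3 (|M_L| + M) / V^2), and
   |M_L| <= o0^2 V. Finally, projecting Gamma on a suitable eigenspace of H
   yields an eigenvector with the same charge and no larger energy. *)
Require Import Defs.
From mathcomp Require Import all_boot all_order all_algebra.
From mathcomp Require Import all_classical all_reals complex ring lra.
Set Implicit Arguments.
Unset Strict Implicit.
Unset Printing Implicit Defensive.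
Import Order.TTheory GRing.Theory Num.Theory.
Local Open Scope ring_scope.
Local Open Scope complex_scope.
Local Open Scope sesquilinear_scope.

(** * Real inner product and norm of kets *)

Lemma eqW (R : numDomainType) (x y : R) : x = y -> x <= y.
Proof. by move=> ->. Qed.

Section RealInnerProduct.
Variable R : realType.
Implicit Type m : nat.

(** Taking the real part makes the form symmetric and [R]-valued. Norms and expectations of
    self-adjoint operators are real, so they survive unchanged. *)
Definition rdot m (u v : 'cV[R[i]]_m) : R := complex.Re (braket u v).

Lemma conjCE (z : R[i]) : Num.conj z = (complex.Re z -i* complex.Im z)%C.
Proof. by case: z. Qed.

Lemma Re_sum (I : Type) (r : seq I) (P : pred I) (F : I -> R[i]) :
  complex.Re (\sum_(i <- r | P i) F i) = \sum_(i <- r | P i) complex.Re (F i).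
Proof.
elim/big_rec2: _ => // k x y _ <-.
by case: (F k) => ? ?; case: y.
Qed.

Lemma rdotE m (u v : 'cV[R[i]]_m) :
  rdot u v = \sum_k (complex.Re (u k 0) * complex.Re (v k 0) +
                     complex.Im (u k 0) * complex.Im (v k 0)).
Proof.
rewrite /rdot /braket mxE Re_sum; apply: eq_bigr => k _.
rewrite !mxE conjCE; case: (u k 0) (v k 0) => [a b] [c d] /=.
by rewrite mulNr opprK.
Qed.

Lemma rdotC m (u v : 'cV[R[i]]_m) : rdot u v = rdot v u.
Proof.
by rewrite !rdotE; apply: eq_bigr => k _; rewrite mulrC [X in _ + X]mulrC.
Qed.

Lemma rdot_adj m (A : 'M[R[i]]_m) u v : rdot (A^t* *m u) v = rdot u (A *m v).
Proof. by rewrite /rdot /braket trmx_mul map_mxM trmxCK mulmxA. Qed.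

Lemma rdotDr m (u v w : 'cV[R[i]]_m) : rdot u (v + w) = rdot u v + rdot u w.
Proof.
rewrite /rdot /braket mulmxDr mxE.
by case: (_ 0 0) => ? ?; case: (_ 0 0).
Qed.

Lemma rdotNr m (u v : 'cV[R[i]]_m) : rdot u (- v) = - rdot u v.
Proof. by rewrite /rdot /braket mulmxN mxE; case: (_ 0 0). Qed.

Lemma rdotBr m (u v w : 'cV[R[i]]_m) : rdot u (v - w) = rdot u v - rdot u w.
Proof. by rewrite rdotDr rdotNr. Qed.

Lemma rdotZr m c (u v : 'cV[R[i]]_m) : rdot u (c%:C *: v) = c * rdot u v.
Proof.
rewrite /rdot /braket -scalemxAr mxE.
by case: (_ 0 0) => a b /=; rewrite mul0r subr0.
Qed.

Lemma rdotDl m (u v w : 'cV[R[i]]_m) : rdot (v + w) u = rdot v u + rdot w u.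
Proof. by rewrite !(rdotC _ u) rdotDr. Qed.

Lemma rdotZl m c (u v : 'cV[R[i]]_m) : rdot (c%:C *: v) u = c * rdot v u.
Proof. by rewrite !(rdotC _ u) rdotZr. Qed.

Lemma rdotNl m (u v : 'cV[R[i]]_m) : rdot (- v) u = - rdot v u.
Proof. by rewrite !(rdotC _ u) rdotNr. Qed.

Lemma rdot0r m (u : 'cV[R[i]]_m) : rdot u 0 = 0.
Proof. by rewrite -(subrr u) rdotBr subrr. Qed.

Lemma rdot_ge0 m (u : 'cV[R[i]]_m) : 0 <= rdot u u.
Proof.
by rewrite rdotE; apply: sumr_ge0 => k _; rewrite addr_ge0 // -expr2 sqr_ge0.
Qed.

Lemma rdot_entry m (u : 'cV[R[i]]_m) k :
  complex.Re (u k 0) ^+ 2 + complex.Im (u k 0) ^+ 2 <= rdot u u.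
Proof.
rewrite rdotE (bigD1 k) //= -!expr2 lerDl.
by apply: sumr_ge0 => j _; rewrite addr_ge0 // -expr2 sqr_ge0.
Qed.

Lemma rdot_eq0 m (u : 'cV[R[i]]_m) : (rdot u u == 0) = (u == 0).
Proof.
apply/eqP/eqP => [u0|->]; last exact: rdot0r.
apply/matrixP => k j; rewrite ord1 mxE.
have := rdot_entry u k; rewrite u0.
case: (u k 0) => a b /= H.
have [a2 b2] : a ^+ 2 = 0 /\ b ^+ 2 = 0.
  by have := sqr_ge0 a; have := sqr_ge0 b; split; lra.
by apply/eqP; rewrite eq_complex /= -(sqrf_eq0 a) -(sqrf_eq0 b) a2 b2 eqxx.
Qed.

Lemma vnorm_ge0 m (u : 'cV[R[i]]_m) : 0 <= vnorm u.
Proof. exact: sqrtr_ge0. Qed.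

Lemma vnorm_sqr m (u : 'cV[R[i]]_m) : vnorm u ^+ 2 = rdot u u.
Proof. by rewrite sqr_sqrtr // rdot_ge0. Qed.

Lemma vnorm_eq0 m (u : 'cV[R[i]]_m) : (vnorm u == 0) = (u == 0).
Proof. by rewrite -sqrf_eq0 vnorm_sqr rdot_eq0. Qed.

Lemma CauchySchwarz_rdot m (u v : 'cV[R[i]]_m) :
  `|rdot u v| <= vnorm u * vnorm v.
Proof.
have [->|v0] := eqVneq v 0.
  by rewrite rdot0r normr0 mulr_ge0 // vnorm_ge0.
rewrite -ler_sqr ?nnegrE ?mulr_ge0 ?vnorm_ge0 //.
rewrite exprMn !vnorm_sqr real_normK ?num_real //.
have vv : 0 < rdot v v by rewrite lt_def rdot_eq0 v0 rdot_ge0.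
set c := rdot u v.
(* Expanding this square gives |v|^2 (|u|^2 |v|^2 - <u, v>^2). *)
have := rdot_ge0 ((rdot v v)%:C *: u - c%:C *: v).
rewrite rdotBr !rdotDl !rdotNl !rdotZl !rdotZr -/c (rdotC v u) -/c.
move: (rdot v v) vv (rdot u u) c => y y0 x z H.
have : 0 <= y * (x * y - z ^+ 2) by lra.
by rewrite pmulr_rge0 // subr_ge0.
Qed.

Lemma vnormD m (u v : 'cV[R[i]]_m) : vnorm (u + v) <= vnorm u + vnorm v.
Proof.
rewrite -ler_sqr ?nnegrE ?addr_ge0 ?vnorm_ge0 //.
rewrite sqrrD !vnorm_sqr rdotDl !rdotDr (rdotC v u).
have := le_trans (ler_norm _) (CauchySchwarz_rdot u v); lra.
Qed.

Lemma vnorm0 m : vnorm (0 : 'cV[R[i]]_m) = 0.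
Proof. by apply/eqP; rewrite vnorm_eq0. Qed.

Lemma vnorm_sum m (I : Type) (r : seq I) (P : pred I) (F : I -> 'cV[R[i]]_m) :
  vnorm (\sum_(i <- r | P i) F i) <= \sum_(i <- r | P i) vnorm (F i).
Proof.
elim/big_ind2: _ => [||//]; first by rewrite vnorm0.
by move=> u x v y ux vy; rewrite (le_trans (vnormD _ _)) // lerD.
Qed.

Lemma vnormZ m (c : R[i]) (u : 'cV[R[i]]_m) :
  vnorm (c *: u) = complex.Re `|c| * vnorm u.
Proof.
apply/eqP; rewrite -(eqrXn2 (n := 2)) ?vnorm_ge0 ?mulr_ge0 ?vnorm_ge0 //;
  last by rewrite normc_def sqrtr_ge0.
rewrite exprMn !vnorm_sqr normc_def sqr_sqrtr ?addr_ge0 ?sqr_ge0 //.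
rewrite !rdotE big_distrr /=; apply/eqP/eq_bigr => k _; rewrite !mxE.
case: c (u k 0) => [a b] [x y] /=; ring.
Qed.

(** A supremum is an upper bound only of a bounded set. On the unit ball every coordinate has
    modulus at most 1, so the sum of the column norms is a bound. *)
Lemma opnormP m (A : 'M[R[i]]_m) v : vnorm (A *m v) <= opnorm A * vnorm v.
Proof.
have [->|v0] := eqVneq v 0; first by rewrite mulmx0 !vnorm0 mulr0.
have vp : 0 < vnorm v by rewrite lt_def vnorm_eq0 v0 vnorm_ge0.
rewrite -ler_pdivrMr // mulrC.
have normV : complex.Re `|(vnorm v)^-1%:C| = (vnorm v)^-1.
  by rewrite ger0_norm // lecR invr_ge0 vnorm_ge0.
have -> : (vnorm v)^-1 * vnorm (A *m v) = vnorm (A *m ((vnorm v)^-1%:C *: v)).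
  by rewrite -scalemxAr vnormZ normV.
apply: sup_upper_bound; last first.
  by exists ((vnorm v)^-1%:C *: v) => //; rewrite vnormZ normV mulVf ?gt_eqF.
split; first by exists (vnorm (A *m 0)); exists 0 => //; rewrite vnorm0 ler01.
exists (\sum_j vnorm (col j A)) => _ [u u1 ->].
have -> : A *m u = \sum_j u j 0 *: col j A.
  apply/matrixP => i k; rewrite ord1 !mxE summxE.
  by apply: eq_bigr => j _; rewrite !mxE mulrC.
apply: le_trans (vnorm_sum _ _ _) _; apply: ler_sum => j _.
rewrite vnormZ ler_piMl ?vnorm_ge0 // normc_def /=.
rewrite -[leRHS]sqrtr1 ler_wsqrtr //.
apply: le_trans (rdot_entry u j) _.
by rewrite -vnorm_sqr expr_le1 // vnorm_ge0.
Qed.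

End RealInnerProduct.

(** * Eigenvectors below a Rayleigh quotient *)

Section SpectralSelection.
Variable R : realType.

(** Entrywise, the hypothesis forces [C i j] to vanish unless [D 0 i = D 0 j], and there [J] agrees
    too. So [C] commutes with functions of [D], such as spectral projections. *)
Lemma diag_commute m (K : numFieldType) (D J : 'rV[K]_m) (C : 'M[K]_m) :
  (forall i j, D 0 i = D 0 j -> J 0 i = J 0 j) ->
  C *m diag_mx D = diag_mx D *m C -> C *m diag_mx J = diag_mx J *m C.
Proof.
move=> DJ /matrixP CD; apply/matrixP => i j; have := CD i j.
rewrite !mul_mx_diag !mul_diag_mx !mxE mulrC => /eqP.
rewrite -subr_eq0 -mulrBl mulf_eq0 => /orP[|/eqP ->]; last by rewrite mul0r mulr0.
by rewrite subr_eq0 => /eqP /esym /DJ ->; rewrite mulrC.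
Qed.

(* The component of [v] in a suitable eigenspace of [H]; [C] preserves it. *)
Lemma commuting_eigenvector m (H C : 'M[R[i]]_m) (v : 'cV_m) (c : R[i]) (e : R) :
  selfadjoint H -> C *m H = H *m C -> v != 0 -> C *m v = c *: v ->
  rdot v (H *m v) <= e * rdot v v ->
  exists Psi E, [/\ eigenvec H E Psi, C *m Psi = c *: Psi & E <= e].
Proof.
move=> Hsa CH v0 Cv le_e.
have Hherm : H \is hermsymmx.
  by apply/is_hermitianmxP; rewrite expr0 scale1r Hsa.
have /orthomx_spectralP HE := hermitian_normalmx Hherm.
have Dreal := hermitian_spectral_diag_real Hherm.
have Uu := spectral_unitarymx H.
move: HE Dreal Uu; set U := spectralmx H; set D := spectral_diag H.
move=> HE Dreal Uu; rewrite (invmx_unitary Uu) in HE.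
have UUt : U *m U^t* = 1%:M by apply/unitarymxP.
have UtU : U^t* *m U = 1%:M.
  by move: Uu; rewrite -trmxC_unitary => /unitarymxP; rewrite trmxCK.
have DE k : D 0 k = (complex.Re (D 0 k))%:C.
  by rewrite RRe_real //; apply: (mxOverP Dreal).
set w := U *m v.
have vE : v = U^t* *m w by rewrite mulmxA UtU mul1mx.
have w0 : w != 0 by apply: contra_neq v0 => w0; rewrite vE w0 mulmx0.
(* The Rayleigh quotient averages the eigenvalues with weights |w k|^2, so some eigenvalue of
   nonzero weight is at most [e]. *)
have [k wk Dk] : exists2 k, w k 0 != 0 & complex.Re (D 0 k) <= e.
  case: (pselect (exists2 k, w k 0 != 0 & complex.Re (D 0 k) <= e)) => // nex.
  have large k : w k 0 != 0 -> e < complex.Re (D 0 k).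
    by move=> wk; rewrite ltNge; apply/negP => Dk; apply: nex; exists k.
  have vv : rdot v v = rdot w w by rewrite {2}/w -rdot_adj mulmxA UtU mul1mx.
  have vHv : rdot v (H *m v) = rdot w (diag_mx D *m w).
    by rewrite HE -!mulmxA -rdot_adj trmxCK.
  have [j wj] : exists j, w j 0 != 0.
    case: (pselect (exists j, w j 0 != 0)) => // nj; case/negP: w0.
    apply/eqP/matrixP => i l; rewrite ord1 [RHS]mxE; apply/eqP.
    by apply/negPn/negP => wi; apply: nj; exists i.
  suff: e * rdot w w < rdot w (diag_mx D *m w) by rewrite -vv -vHv ltNge le_e.
  have sq_ge0 l : 0 <= complex.Re (w l 0) ^+ 2 + complex.Im (w l 0) ^+ 2.
    by rewrite addr_ge0 ?sqr_ge0.
  have sq_gt0 l : w l 0 != 0 ->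
      0 < complex.Re (w l 0) ^+ 2 + complex.Im (w l 0) ^+ 2.
    move=> wl; rewrite lt_def sq_ge0 andbT; apply: contra_neq wl.
    move=> /eqP; rewrite paddr_eq0 ?sqr_ge0 // !sqrf_eq0 => /andP[/eqP a /eqP b].
    by apply/eqP; rewrite eq_complex a b !eqxx.
  rewrite !rdotE mulr_sumr -subr_gt0 -sumrB (bigD1 j) //=.
  have term l : complex.Re (w l 0) * complex.Re ((diag_mx D *m w) l 0) +
      complex.Im (w l 0) * complex.Im ((diag_mx D *m w) l 0) -
      e * (complex.Re (w l 0) * complex.Re (w l 0) +
           complex.Im (w l 0) * complex.Im (w l 0)) =
    (complex.Re (D 0 l) - e) *
      (complex.Re (w l 0) ^+ 2 + complex.Im (w l 0) ^+ 2).
    by rewrite mul_diag_mx mxE DE; case: (w l 0) => a b /=; ring.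
  rewrite term; apply: ltr_pwDl.
    by rewrite mulr_gt0 ?sq_gt0 ?subr_gt0 ?large.
  apply: sumr_ge0 => l _; rewrite term.
  have [->|wl] := eqVneq (w l 0) 0; first by rewrite /= expr0n /= addr0 mulr0.
  by rewrite mulr_ge0 // subr_ge0 ltW // large.
(* [J] selects the whole eigenspace of [D 0 k] and not just the coordinate [k], so that the
   projection commutes with the charge. *)
pose J : 'rV[R[i]]_m := \row_j (D 0 j == D 0 k)%:R.
have DJ : diag_mx D *m diag_mx J = D 0 k *: diag_mx J.
  apply/matrixP => i j; rewrite mul_diag_mx !mxE.
  have [_|_] := eqVneq i j; last by rewrite !mulr0n !mulr0.
  by rewrite !mulr1n; case: eqP => [->|_]; rewrite ?mulr0.
pose C' := U *m C *m U^t*.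
have C'D : C' *m diag_mx D = diag_mx D *m C'.
  have HU : H *m U^t* = U^t* *m diag_mx D by rewrite HE -!mulmxA UUt mulmx1.
  have UH : U *m H = diag_mx D *m U by rewrite HE !mulmxA UUt mul1mx.
  by rewrite /C' -mulmxA -HU !mulmxA -UH -(mulmxA U C H) CH mulmxA.
have C'J : C' *m diag_mx J = diag_mx J *m C'.
  by apply: diag_commute C'D => i j; rewrite !mxE => ->.
exists (U^t* *m (diag_mx J *m w)), (complex.Re (D 0 k)); split => //.
  split.
    apply: contra_neq wk => /(congr1 (mulmx U)).
    rewrite mulmxA UUt mul1mx mulmx0 => /matrixP /(_ k 0).
    by rewrite mul_diag_mx !mxE eqxx mul1r.
  rewrite {1}HE -!mulmxA (mulmxA U) UUt mul1mx (mulmxA (diag_mx D)) DJ.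
  by rewrite -scalemxAl -scalemxAr -DE.
have -> : C *m (U^t* *m (diag_mx J *m w)) =
    U^t* *m (C' *m diag_mx J *m w) by rewrite /C' !mulmxA UtU mul1mx.
rewrite C'J -mulmxA /C' -!mulmxA -vE Cv -!scalemxAr.
by [].
Qed.

(** A vector of smaller Rayleigh quotient would yield an eigenvalue below [e], by
    [commuting_eigenvector] with the identity as charge. *)
Lemma lowest_eigenvalue_le m (H : 'M[R[i]]_m) e v :
  selfadjoint H -> lowest_eigenvalue H e -> e * rdot v v <= rdot v (H *m v).
Proof.
move=> Hsa [_ low]; rewrite leNgt; apply/negP => lt_e.
have v0 : v != 0.
  by apply: contraTneq lt_e => ->; rewrite mulmx0 !rdot0r mulr0 ltxx.
have vv : 0 < rdot v v by rewrite lt_def rdot_eq0 v0 rdot_ge0.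
have [Psi [E [HE _ Ele]]] := @commuting_eigenvector _ H 1%:M v 1
  (rdot v (H *m v) / rdot v v) Hsa ltac:(by rewrite mul1mx mulmx1) v0
  ltac:(by rewrite mul1mx scale1r) ltac:(by rewrite divfK ?gt_eqF).
have := le_trans (low _ _ HE) Ele.
by rewrite leNgt ltr_pdivrMr ?lt_e.
Qed.
End SpectralSelection.

(** * Energy of the tower states *)

(* Used with K = R[i], emb the inclusion of the reals, and dot the real part
   of the inner product. *)
Section Tower.
Variables (R : realType) (K : numClosedFieldType) (N : nat).
Variables (emb : {rmorphism R -> K}) (dot : 'cV[K]_N -> 'cV[K]_N -> R).
Hypothesis dotC : forall u v, dot u v = dot v u.
Hypothesis dotDr : forall u v w, dot u (v + w) = dot u v + dot u w.
Hypothesis dotNr : forall u v, dot u (- v) = - dot u v.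
Hypothesis dotZr : forall c u v, dot u (emb c *: v) = c * dot u v.
Hypothesis dot_ge0 : forall u, 0 <= dot u u.
Let norm u := Num.sqrt (dot u u).
Hypothesis dot_CS : forall u v, `|dot u v| <= norm u * norm v.

Local Notation Op := 'M[K]_N.
Variables (A B C : Op) (Phi : 'cV[K]_N) (mu : R).
Hypothesis dot_B : forall u v, dot u (B *m v) = dot (A *m u) v.
Hypothesis commAB : A * B - B * A = C *+ 2.
Hypothesis commCA : C * A - A * C = A.
Hypothesis commCB : C * B - B * C = - B.
Hypothesis CPhi : C *m Phi = emb mu *: Phi.

Lemma dotBr u v w : dot u (v - w) = dot u v - dot u w.
Proof. by rewrite dotDr dotNr. Qed.

Lemma dotZl c u v : dot (emb c *: u) v = c * dot u v.
Proof. by rewrite !(dotC _ v) dotZr. Qed.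

Lemma dot0r u : dot u 0 = 0.
Proof. by rewrite -(subrr u) dotBr subrr. Qed.

Lemma norm_ge0 u : 0 <= norm u.
Proof. exact: sqrtr_ge0. Qed.

Lemma norm_sqr u : norm u ^+ 2 = dot u u.
Proof. by rewrite sqr_sqrtr. Qed.

Lemma mulv (X Y : Op) (v : 'cV_N) : (X * Y) *m v = X *m (Y *m v).
Proof. by rewrite mulmxA. Qed.

Lemma dot_A u v : dot u (A *m v) = dot (B *m u) v.
Proof. by rewrite dotC -dot_B dotC. Qed.

Lemma dot_Bexp c u v : dot u (B ^+ c *m v) = dot (A ^+ c *m u) v.
Proof.
elim: c u v => [|c IH] u v; first by rewrite !expr0 !mul1mx.
by rewrite exprS exprSr !mulv dot_B IH.
Qed.

Lemma charge_Bexp b nu (w : 'cV_N) : C *m w = emb nu *: w ->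
  C *m (B ^+ b *m w) = emb (nu - b%:R) *: (B ^+ b *m w).
Proof.
move=> Cw; elim: b => [|b IH]; first by rewrite expr0 mul1mx subr0.
have -> : nu - b.+1%:R = nu - b%:R - 1 by rewrite -natr1 opprD addrA.
rewrite exprS mulv -mulv (_ : C * B = B * C - B); last first.
  by rewrite -commCB addrC subrK.
rewrite mulmxBl mulv IH -scalemxAr -scaleN1r -scalerDl.
by rewrite -(rmorphN1 emb) -rmorphD.
Qed.

Lemma charge_Aexp b nu (w : 'cV_N) : C *m w = emb nu *: w ->
  C *m (A ^+ b *m w) = emb (nu + b%:R) *: (A ^+ b *m w).
Proof.
move=> Cw; elim: b => [|b IH]; first by rewrite expr0 mul1mx addr0.
have -> : nu + b.+1%:R = nu + b%:R + 1 by rewrite -natr1 addrA.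
rewrite exprS mulv -mulv (_ : C * A = A * C + A); last first.
  by rewrite -{3}commCA addrC subrK.
rewrite mulmxDl mulv IH -scalemxAr -[X in _ + X]scale1r -scalerDl.
by rewrite -(rmorph1 emb) -rmorphD.
Qed.

Lemma lower_A (v : 'cV_N) :
  B *m (A *m v) = A *m (B *m v) - emb 2%:R *: (C *m v).
Proof.
have AB : A * B = B * A + C *+ 2 by rewrite -commAB addrC subrK.
rewrite -(mulv A B v) AB mulmxDl (mulv B A v) mulr2n mulmxDl -mulr2n.
by rewrite rmorph_nat scaler_nat addrK.
Qed.

(** Pulling [B] through [A ^+ b.+1] leaves a term - 2 C for each factor [A], evaluated at the
    charges nu, nu + 1, ..., nu + b. Twice their sum is (b + 1)(2 nu + b). *)
Lemma lower_Aexp b nu (w : 'cV_N) : C *m w = emb nu *: w ->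
  B *m (A ^+ b.+1 *m w) = A ^+ b.+1 *m (B *m w)
     - emb (b.+1%:R * (2%:R * nu + b%:R)) *: (A ^+ b *m w).
Proof.
move=> Cw; elim: b => [|b IH].
  rewrite expr1 expr0 mul1mx lower_A Cw scalerA.
  by rewrite -rmorphM addr0 mul1r.
rewrite [in LHS]exprS (exprS A b.+1) !mulv lower_A IH (charge_Aexp b.+1 Cw).
rewrite mulmxBr -scalemxAr -[A *m (A ^+ b *m w)]mulv -exprS scalerA -addrA.
rewrite -opprD -scalerDl -rmorphM -rmorphD; congr (_ - emb _ *: _).
by rewrite -!natr1; ring.
Qed.

(** * Growth of the norms along the tower *)

Section NormGrowth.
Variables (M : nat) (Q kappa tau : R).
Hypothesis Phi1 : dot Phi Phi = 1.
Hypothesis kappaP : 2 * (`|mu| + M%:R) <= kappa.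
Hypothesis Mkappa : M%:R * kappa <= Q.
Hypothesis order : 2 * Q - mu <= dot (A *m Phi) (A *m Phi).
Hypothesis Q_gt0 : 0 < Q.
Local Notation a k := (dot (A ^+ k *m Phi) (A ^+ k *m Phi)).

Lemma kappa_ge0 : 0 <= kappa.
Proof. by apply: le_trans kappaP; rewrite mulr_ge0 // addr_ge0. Qed.

Lemma norm_B_sqr nu (w : 'cV_N) : C *m w = emb nu *: w ->
  dot (B *m w) (B *m w) = dot (A *m w) (A *m w) + 2 * nu * dot w w.
Proof.
move=> Cw; rewrite -dot_A -dot_B lower_A Cw dotBr !dotZr mulrA; ring.
Qed.

(* With w = A u, Cauchy-Schwarz gives |w|^4 <= |u|^2 |B w|^2, and |B w|^2
   exceeds |A w|^2 by at most kappa |w|^2. *)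
Lemma ratio_step (u : 'cV_N) nu q : C *m u = emb nu *: u ->
  2 * (nu + 1) <= kappa -> 0 < dot u u ->
  q * dot u u <= dot (A *m u) (A *m u) ->
  (q - kappa) * dot (A *m u) (A *m u) <= dot (A *m (A *m u)) (A *m (A *m u)).
Proof.
move=> Cu nuk u0 qu.
have CAu : C *m (A *m u) = emb (nu + 1) *: (A *m u).
  by have := charge_Aexp 1 Cu; rewrite expr1.
have := norm_B_sqr CAu.
have : dot (A *m u) (A *m u) <= norm u * norm (B *m (A *m u)).
  rewrite -dot_B; apply: le_trans (dot_CS _ _); exact: ler_norm.
move: (A *m u) qu => w qu cs Bw.
have sq : dot w w ^+ 2 <= dot u u * dot (B *m w) (B *m w).
  rewrite -(norm_sqr u) -(norm_sqr (B *m w)) -exprMn.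
  by rewrite ler_sqr // nnegrE ?dot_ge0 // mulr_ge0 ?norm_ge0.
move: sq qu; rewrite Bw.
move: (dot w w) (dot_ge0 w) (dot (A *m w) (A *m w)) => y y0 z.
move: (dot u u) u0 => x x0 sq qu; rewrite -(ler_pM2l x0).
have := ler_wpM2r y0 qu.
have := ler_wpM2l (ltW x0) (ler_wpM2r y0 nuk).
lra.
Qed.

(** The first ratio is at least 2 Q - mu, hence 2 Q - kappa, and by [ratio_step] each further step
    loses at most another [kappa]. As M kappa <= Q, the ratios stay above [Q] and the norms
    positive. *)
Lemma tower_ratio k : (k < M)%N ->
  0 < a k /\ (2 * Q - k.+1%:R * kappa) * a k <= a k.+1.
Proof.
elim: k => [|k IH] kM.
  rewrite expr0 mul1mx expr1 Phi1; split=> //; rewrite mulr1 mul1r.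
  apply: le_trans order; rewrite lerB // (le_trans _ kappaP) //.
  apply: le_trans (ler_norm _) _.
  by have := normr_ge0 mu; have := ler0n R M; lra.
have [ak rk] := IH (ltnW kM).
have kk : Q <= 2 * Q - k.+1%:R * kappa.
  have /le_trans/(_ Mkappa) : k.+1%:R * kappa <= M%:R * kappa.
    by rewrite ler_wpM2r ?kappa_ge0 // ler_nat ltnW.
  lra.
have expS j : A ^+ j.+1 *m Phi = A *m (A ^+ j *m Phi).
  by rewrite (exprS A) (mulv A).
split; first by apply: lt_le_trans rk; rewrite mulr_gt0 // (lt_le_trans Q_gt0).
have nu_le : 2 * (mu + k%:R + 1) <= kappa.
  rewrite -addrA natr1; apply: le_trans kappaP.
  by rewrite ler_pM2l // lerD ?ler_norm // ler_nat ltnW.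
rewrite expS in rk; rewrite !expS.
apply: le_trans (ratio_step (charge_Aexp k CPhi) nu_le ak rk).
apply: eqW; rewrite -(natr1 k.+1); move: (dot _ _) => y; ring.
Qed.

Hypothesis tau_gt0 : 0 < tau.
Hypothesis tauQ : tau ^+ 2 * Q = 1.

(** The ratio bound of [tower_ratio] is at least [Q], the inverse of [tau ^+ 2]. *)
Lemma tower_norm_step k : (k < M)%N ->
  norm (A ^+ k *m Phi) <= tau * norm (A ^+ k.+1 *m Phi).
Proof.
move=> kM; rewrite -ler_sqr ?nnegrE ?mulr_ge0 ?norm_ge0 ?(ltW tau_gt0) //.
rewrite exprMn !norm_sqr; have [_] := tower_ratio kM.
move: (dot (A ^+ k.+1 *m _) _) => y.
move: (dot _ _) (dot_ge0 (A ^+ k *m Phi)) => x x0 xy.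
rewrite -[leLHS]mul1r -tauQ -mulrA ler_wpM2l ?sqr_ge0 //.
apply: le_trans xy; rewrite ler_wpM2r //.
have /le_trans/(_ Mkappa) : k.+1%:R * kappa <= M%:R * kappa.
  by rewrite ler_wpM2r ?kappa_ge0 // ler_nat.
lra.
Qed.

Lemma tower_norm k : (k <= M)%N ->
  norm (A ^+ k *m Phi) <= tau ^+ (M - k) * norm (A ^+ M *m Phi).
Proof.
move=> kM; rewrite -[in leLHS](subKn kM).
elim: (M - k)%N (leq_subr k M) => [|d IH] dM; first by rewrite expr0 subn0 mul1r.
have dM' : (M - d.+1 < M)%N by rewrite ltn_subrL (leq_trans _ dM).
apply: le_trans (tower_norm_step dM') _.
by rewrite (exprS tau) -mulrA ler_wpM2l ?(ltW tau_gt0) // -subSn // subSS IH // ltnW.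
Qed.

Lemma tower_gt0 : (0 < M)%N -> 0 < a M.
Proof.
move=> M0; have [a0] := @tower_ratio M.-1 ltac:(by rewrite prednK).
rewrite prednK //.
move: (dot (A ^+ M *m _) _) => y.
move: (dot _ _) a0 => x x0 xy.
apply: lt_le_trans xy; rewrite mulr_gt0 //.
by apply: lt_le_trans Q_gt0 _; have := Mkappa; lra.
Qed.

(** * Moving local operators through words in the ladder operators *)

Section LocalOperators.
(** [loc r X] stands for a local [X] of norm at most [r]. Locality enters only through [locA] and
    [locB]: a commutator with a ladder operator stays local at the price of a fixed factor [s2]. *)
Variables (loc : R -> Op -> Prop) (s2 : R).
Hypothesis s2_ge0 : 0 <= s2.
Hypothesis loc_ge0 : forall r X, loc r X -> 0 <= r.
Hypothesis loc_norm : forall r X v, loc r X -> norm (X *m v) <= r * norm v.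
Hypothesis locA : forall r X, loc r X -> loc (s2 * r) (A * X - X * A).
Hypothesis locB : forall r X, loc r X -> loc (s2 * r) (B * X - X * B).

(** [phi] is the ground state expectation and [W] the squared norm of the trial state. Relative to
    [W], [t] is the cost of one local commutator, [gain] that of carrying one [B] across all the
    [A]'s, and [G] allows for up to [M] nested commutators. *)
Let phi (Y : Op) := dot Phi (Y *m Phi).
Let W := norm (A ^+ M *m Phi) ^+ 2.
Let t := s2 * tau.
Let G := (1 + t) ^+ M * W.
Let gain := 2 * M%:R * kappa * tau ^+ 2.

Lemma phiD X Y : phi (X + Y) = phi X + phi Y.
Proof. by rewrite /phi mulmxDl dotDr. Qed.

Lemma phiB X Y : phi (X - Y) = phi X - phi Y.
Proof. by rewrite /phi mulmxBl dotBr. Qed.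

Lemma W_ge0 : 0 <= W. Proof. exact: sqr_ge0. Qed.
Lemma t_ge0 : 0 <= t. Proof. by rewrite mulr_ge0 // ltW. Qed.
Lemma tau_ge0 : 0 <= tau. Proof. exact: ltW. Qed.
Lemma growth_ge1 k : 1 <= (1 + t) ^+ k.
Proof. by rewrite exprn_ege1 // lerDl t_ge0. Qed.
Lemma growth_le k : (k <= M)%N -> (1 + t) ^+ k <= (1 + t) ^+ M.
Proof. by move=> kM; rewrite ler_weXn2l // lerDl t_ge0. Qed.
Lemma G_ge0 : 0 <= G.
Proof. by rewrite mulr_ge0 ?W_ge0 // (le_trans _ (growth_ge1 M)). Qed.
Lemma gain_ge0 : 0 <= gain.
Proof. by rewrite !mulr_ge0 ?kappa_ge0 ?tau_ge0. Qed.

(** The adjoint of [B ^+ c] is [A ^+ c], so Cauchy-Schwarz separates the word into two tower states,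
    each compared with the top one by [tower_norm]. *)
Lemma phi_sandwich r X c b : loc r X -> (c <= M)%N -> (b <= M)%N ->
  `|phi (B ^+ c * X * A ^+ b)| <= r * W * tau ^+ (M - c) * tau ^+ (M - b).
Proof.
move=> rX cM bM; rewrite /phi !mulv dot_Bexp.
apply: le_trans (dot_CS _ _) _.
have := ler_pM (norm_ge0 _) (norm_ge0 _) (tower_norm cM)
  (le_trans (loc_norm _ rX) (ler_wpM2l (loc_ge0 rX) (tower_norm bM))).
move=> /le_trans; apply; rewrite /W; apply/eqW; ring.
Qed.

Lemma tau_sub k : (k < M)%N -> tau ^+ (M - k) = tau * tau ^+ (M - k.+1).
Proof. by move=> kM; rewrite -exprS subnSK. Qed.

(** The [B]'s right of [X] move to its left one by one. Each either passes or is absorbed in a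
    commutator, which costs [s2] and saves one [tau]: a factor 1 + t per [B]. *)
Lemma phi_shuffle r X c a b : loc r X -> (c + a <= M)%N -> (b <= M)%N ->
  `|phi (B ^+ c * X * B ^+ a * A ^+ b)| <=
    r * W * tau ^+ (M - (c + a)) * tau ^+ (M - b) * (1 + t) ^+ a.
Proof.
move=> + + bM; elim: a c r X => [|a IH] c r X rX caM.
  by rewrite addn0 in caM *; rewrite !expr0 !mulr1; apply: phi_sandwich.
have -> : B ^+ c * X * B ^+ a.+1 * A ^+ b =
    B ^+ c.+1 * X * B ^+ a * A ^+ b - B ^+ c * (B * X - X * B) * B ^+ a * A ^+ b.
  by rewrite mulrBr !mulrBl (exprSr B c) (exprS B a) !mulrA opprB addrC subrK.
rewrite phiB; apply: le_trans (ler_normB _ _) _.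
have le1 := IH c.+1 r X rX ltac:(by rewrite addSnnS).
have le2 := IH c _ _ (locB rX) ltac:(by rewrite (leq_trans _ caM) // addnS).
apply: le_trans (lerD le1 le2) _.
rewrite (tau_sub (k := (c + a)%N)); last by rewrite -addnS.
by rewrite addSnnS -addnS (exprS (1 + t)) /t; apply/eqW; ring.
Qed.

(** One [B] crosses all the [A]'s at once, by [lower_Aexp] on the state [B ^+ a *m Phi] of charge mu
    - a. *)
Lemma lower_step X c b a :
  phi (X * B ^+ c * A ^+ b.+1 * B ^+ a.+1) = phi (X * B ^+ c.+1 * A ^+ b.+1 * B ^+ a)
   + b.+1%:R * (2%:R * (mu - a%:R) + b%:R) * phi (X * B ^+ c * A ^+ b * B ^+ a).
Proof.
rewrite /phi (exprSr B c) (exprS B a) !mulrA !mulv.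
rewrite [B *m (A ^+ b.+1 *m _)](lower_Aexp b (charge_Bexp a CPhi)).
by rewrite !mulmxBr -!scalemxAr dotBr dotZr subrK.
Qed.

Lemma lower_coef_le a b : (a <= M)%N -> (b < M)%N ->
  `|b.+1%:R * (2%:R * (mu - a%:R) + b%:R)| <= M%:R * kappa.
Proof.
move=> aM bM; rewrite normrM normr_nat ler_pM ?ler0n ?normr_ge0 ?ler_nat //.
apply: le_trans kappaP.
have aR : a%:R <= M%:R :> R by rewrite ler_nat.
have bR : b%:R <= M%:R :> R by rewrite ler_nat ltnW.
have [a0 b0] : 0 <= a%:R :> R /\ 0 <= b%:R :> R by split; apply: ler0n.
have := ler_norm mu; have := ler_norm (- mu); rewrite normrN => mu1 mu2.
by rewrite ler_norml; apply/andP; split; lra.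
Qed.

(* Exchanging an A and a B costs a factor |C| <= kappa but removes both
   of them, which gains tau ^ 2. *)
Lemma phi_reorder r X b c a : loc r X -> (c + a <= M)%N -> (b <= M)%N ->
  2 * M%:R * (M%:R * kappa) * tau ^+ 2 <= 1 ->
  `|phi (X * B ^+ c * A ^+ b * B ^+ a) - phi (X * B ^+ (c + a) * A ^+ b)| <=
    r * G * tau ^+ (M - (c + a)) * tau ^+ (M - b) * (a%:R * gain).
Proof.
move=> rX + + gain1.
have r0 := loc_ge0 rX; have rG : 0 <= r * G by rewrite mulr_ge0 // G_ge0.
have tk k : 0 <= tau ^+ k by exact: exprn_ge0 tau_ge0.
have rhs_ge0 c' b' k : 0 <= r * G * tau ^+ c' * tau ^+ b' * (k%:R * gain).
  exact: (mulr_ge0 (mulr_ge0 (mulr_ge0 rG (tk _)) (tk _))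
    (mulr_ge0 (ler0n _ _) gain_ge0)).
(* Outer induction on the number of [A]'s, inner induction on the number of [B]'s to move: the
   correction term in [lower_step] has one fewer of each. *)
elim: b c a => [|b IHb] c a caM bM.
  have -> : X * B ^+ c * A ^+ 0 * B ^+ a = X * B ^+ (c + a) * A ^+ 0.
    by rewrite expr0 !mulr1 -mulrA -exprD.
  by rewrite subrr normr0.
elim: a c caM => [|a IHa] c caM.
  have -> : X * B ^+ c * A ^+ b.+1 * B ^+ 0 = X * B ^+ (c + 0) * A ^+ b.+1.
    by rewrite expr0 mulr1 addn0.
  by rewrite subrr normr0.
rewrite lower_step addrAC; apply: le_trans (ler_normD _ _) _.
have le1 := IHa c.+1 ltac:(by rewrite addSnnS); rewrite addSnnS in le1.
have ca : (c + a < M)%N by rewrite -addnS.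
have le0 : `|phi (X * B ^+ (c + a) * A ^+ b)| <=
    r * G * tau ^+ (M - (c + a)) * tau ^+ (M - b).
  have := phi_shuffle (c := 0) rX (ltnW ca) (ltnW bM).
  rewrite expr0 mul1r add0n => /le_trans; apply.
  apply: le_trans (ler_wpM2l _ (growth_le (ltnW ca))) _.
    exact: (mulr_ge0 (mulr_ge0 (mulr_ge0 r0 W_ge0) (tk _)) (tk _)).
  by rewrite /G; apply/eqW; ring.
(* The induction hypothesis for [b] puts this word within a * gain <= M * gain <= 1 times the bound
   for the ordered one, hence the factor 2 in [gain]. *)
have le2 : `|phi (X * B ^+ c * A ^+ b * B ^+ a)| <=
    2 * (r * G * tau ^+ (M - (c + a)) * tau ^+ (M - b)).
  rewrite -[phi _](subrK (phi (X * B ^+ (c + a) * A ^+ b))).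
  apply: le_trans (ler_normD _ _) _; rewrite mulr2n mulrDl mul1r lerD //.
  apply: le_trans (IHb c a (ltnW ca) (ltnW bM)) _.
  rewrite ler_piMr ?(mulr_ge0 (mulr_ge0 rG (tk _)) (tk _)) //.
  apply: le_trans gain1; rewrite /gain.
  have aM : a%:R <= M%:R :> R.
    by rewrite ler_nat (leq_trans (leq_addl c a)) // ltnW.
  have := ler_wpM2r gain_ge0 aM; rewrite /gain => /le_trans; apply.
  by apply/eqW; ring.
have aM : (a <= M)%N by rewrite (leq_trans (leq_addl c a)) // ltnW.
apply: le_trans (lerD le1 (eqW (normrM _ _))) _.
have := ler_pM (normr_ge0 _) (normr_ge0 _) (lower_coef_le aM bM) le2.
rewrite (tau_sub ca) (tau_sub bM) -addnS => le3.
apply: le_trans (lerD (lexx _) le3) _.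
by rewrite -(natr1 a) /gain; apply/eqW; ring.
Qed.

Hypothesis few_swaps : 2 * M%:R * (M%:R * kappa) * tau ^+ 2 <= 1.

(** In [beta], M t pays for [B ^+ M] crossing a local operator and M gain for its crossing the
    [A]'s. *)
Let comm_B (Y : Op) := phi (B ^+ M * Y - Y * B ^+ M).
Let beta := G * (M%:R * t + M%:R * gain).

Lemma comm_BD X Y : comm_B (X + Y) = comm_B X + comm_B Y.
Proof. by rewrite /comm_B mulrDr mulrDl opprD addrACA phiD. Qed.

Lemma comm_BB X Y : comm_B (X - Y) = comm_B X - comm_B Y.
Proof. by apply/eqP; rewrite eq_sym subr_eq -comm_BD subrK. Qed.

Lemma beta_ge0 : 0 <= beta.
Proof.
by rewrite mulr_ge0 ?G_ge0 // addr_ge0 // mulr_ge0 // ?gain_ge0 ?t_ge0.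
Qed.

(** The [B]'s left of [X] cross it one at a time. In each commutator term the [B]'s still on the
    right are brought back by [phi_shuffle]. *)
Lemma phi_pass r X k b : loc r X -> (k <= M)%N -> (b <= M)%N ->
  `|phi (B ^+ k * X * B ^+ (M - k) * A ^+ b) - phi (X * B ^+ M * A ^+ b)| <=
    r * G * tau ^+ (M - b) * (k%:R * t).
Proof.
move=> rX + bM; elim: k => [|k IH] kM.
  by rewrite expr0 mul1r subn0 subrr normr0 !mul0r mulr0.
have -> : B ^+ k.+1 * X * B ^+ (M - k.+1) * A ^+ b =
    B ^+ k * X * B ^+ (M - k) * A ^+ b
    + B ^+ k * (B * X - X * B) * B ^+ (M - k.+1) * A ^+ b.
  rewrite -(subnSK kM) (exprSr B k) (exprS B (M - k.+1)) mulrBr !mulrBl !mulrA.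
  by rewrite addrC subrK.
rewrite phiD addrAC; apply: le_trans (ler_normD _ _) _.
have sub1 : (k + (M - k.+1) < M)%N by rewrite -addSn subnKC.
(* One of the [M] factors [B] went into the commutator, so exactly one [tau] remains. *)
have sub2 : (M - (k + (M - k.+1)) = 1)%N by rewrite -{1}(subnKC kM) addSn subSnn.
have le2 := phi_shuffle (c := k) (a := (M - k.+1)%N) (locB rX)
  (ltnW sub1) bM.
rewrite sub2 in le2.
apply: le_trans (lerD (IH (ltnW kM)) le2) _.
rewrite -(natr1 k) (mulrDl _ _ t) mulrDr mul1r lerD //.
have := ler_wpM2l _ (growth_le (leq_subr k.+1 M)).
move=> /(_ (s2 * r * W * tau ^+ 1 * tau ^+ (M - b)) _)/le_trans; apply;
  last by rewrite /G /t; apply/eqW; ring.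
have tk j : 0 <= tau ^+ j by exact: exprn_ge0 tau_ge0.
exact: (mulr_ge0 (mulr_ge0 (mulr_ge0 (loc_ge0 (locB rX)) W_ge0) (tk _)) (tk _)).
Qed.

(** [B ^+ M] first crosses [X] by [phi_pass], then [A ^+ b] by [phi_reorder]. *)
Lemma comm_B_loc r X b : loc r X -> (b <= M)%N ->
  `|comm_B (X * A ^+ b)| <= r * tau ^+ (M - b) * beta.
Proof.
move=> rX bM.
have le1 := phi_pass rX (leqnn M) bM.
rewrite subnn expr0 mulr1 in le1.
have le2 := phi_reorder (c := 0) (a := M) rX (leqnn M) bM few_swaps.
rewrite !expr0 !mulr1 !add0n subnn expr0 mulr1 distrC in le2.
rewrite /comm_B phiB mulrA.
apply: le_trans (ler_distD (phi (X * B ^+ M * A ^+ b)) _ _) _.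
by apply: le_trans (lerD le1 le2) _; rewrite /beta; apply/eqW; ring.
Qed.

(** The [A]'s left of [X] move to its right, each at the price of a factor 1 + t, until [comm_B_loc]
    applies. *)
Lemma comm_B_sandwich r X j b : loc r X -> (j + b <= M)%N ->
  `|comm_B (A ^+ j * X * A ^+ b)| <=
    r * tau ^+ (M - (j + b)) * beta * (1 + t) ^+ j.
Proof.
elim: j r X b => [|j IH] r X b rX jbM.
  by rewrite expr0 mul1r mulr1 add0n; apply: comm_B_loc.
have -> : A ^+ j.+1 * X * A ^+ b =
    A ^+ j * X * A ^+ b.+1 + A ^+ j * (A * X - X * A) * A ^+ b.
  by rewrite mulrBr mulrBl exprSr exprS !mulrA addrC subrK.
rewrite comm_BD; apply: le_trans (ler_normD _ _) _.
have le1 := IH r X b.+1 rX ltac:(by rewrite -addSnnS).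
have le2 := IH _ _ b (locA rX) (ltnW jbM).
apply: le_trans (lerD le1 le2) _.
rewrite (tau_sub (k := (j + b)%N)) // addnS addSn.
by rewrite (exprS (1 + t)) /t; apply/eqW; ring.
Qed.

(* Each of the two commutators costs a factor M t. *)
Lemma double_commutator_le r X : loc r X ->
  `|comm_B (X * A ^+ M - A ^+ M * X)| <=
    r * (1 + t) ^+ M * (M%:R * t) * beta.
Proof.
move=> rX.
(* The words A^k X A^(M-k) interpolate between the two terms of [X, A^M], and consecutive ones
   differ by one local commutator. *)
have H k : (k <= M)%N -> `|comm_B (X * A ^+ M - A ^+ k * X * A ^+ (M - k))| <=
    r * (1 + t) ^+ M * (k%:R * t) * beta.
  elim: k => [|k IH] kM.
    rewrite expr0 mul1r subn0 subrr /comm_B mulr0 mul0r subrr /phi mul0mx.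
    by rewrite dot0r normr0 !mul0r mulr0 mul0r.
  have -> : X * A ^+ M - A ^+ k.+1 * X * A ^+ (M - k.+1) =
      (X * A ^+ M - A ^+ k * X * A ^+ (M - k))
      - A ^+ k * (A * X - X * A) * A ^+ (M - k.+1).
    rewrite -(subnSK kM) (exprSr A k) (exprS A (M - k.+1)) mulrBr !mulrBl !mulrA.
    by rewrite opprB addrA subrK.
  rewrite comm_BB; apply: le_trans (ler_normB _ _) _.
  have sub1 : (k + (M - k.+1) < M)%N by rewrite -addSn subnKC.
  have sub2 : (M - (k + (M - k.+1)) = 1)%N by rewrite -{1}(subnKC kM) addSn subSnn.
  have le2 := comm_B_sandwich (j := k) (b := (M - k.+1)%N) (locA rX)
    (ltnW sub1).
  rewrite sub2 in le2.
  apply: le_trans (lerD (IH (ltnW kM)) le2) _.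
  rewrite -(natr1 k) (mulrDl _ _ t) mulrDr (mulrDl _ _ beta) lerD // mul1r.
  have := ler_wpM2l _ (growth_le (ltnW kM)) => /(_ (s2 * r * tau ^+ 1 * beta)).
  move=> /(_ _)/le_trans; apply; last by rewrite /t; apply/eqW; ring.
  exact: (mulr_ge0 (mulr_ge0 (loc_ge0 (locA rX)) (exprn_ge0 _ tau_ge0)) beta_ge0).
by have := H M (leqnn M); rewrite subnn expr0 mulr1.
Qed.

(* For a ground state the double commutator is the sum of the energy excesses
   of A ^ M Phi and B ^ M Phi, and the latter is nonnegative. *)
Theorem tower_energy (X : finType) (h : X -> Op) (h0 E0 : R) (H : Op) :
  H = \sum_x h x -> (forall u v, dot (H *m u) v = dot u (H *m v)) ->
  H *m Phi = emb E0 *: Phi ->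
  (forall v, E0 * dot v v <= dot v (H *m v)) ->
  (forall x, loc h0 (h x)) ->
  dot (A ^+ M *m Phi) (H *m (A ^+ M *m Phi)) <=
    (E0 + #|X|%:R * (h0 * ((1 + t) ^+ M) ^+ 2 *
      (M%:R * t) * (M%:R * t + M%:R * gain))) * a M.
Proof.
move=> HE Hsa HPhi low hloc; set Gamma := A ^+ M *m Phi.
have sumB : comm_B (H * A ^+ M - A ^+ M * H) <=
    #|X|%:R * (h0 * (1 + t) ^+ M * (M%:R * t) * beta).
  have -> : H * A ^+ M - A ^+ M * H = \sum_x (h x * A ^+ M - A ^+ M * h x).
    by rewrite HE mulr_suml mulr_sumr sumrB.
  have -> : comm_B (\sum_x (h x * A ^+ M - A ^+ M * h x)) =
      \sum_x comm_B (h x * A ^+ M - A ^+ M * h x).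
    apply: (big_morph comm_B comm_BD).
    by rewrite /comm_B mulr0 mul0r subrr /phi mul0mx dot0r.
  rewrite mulr_natl -sumr_const; apply: ler_sum => x _.
  exact: le_trans (ler_norm _) (double_commutator_le (hloc x)).
pose Delta := B ^+ M *m Phi.
have Aexp u v : dot u (A ^+ M *m v) = dot (B ^+ M *m u) v.
  by rewrite dotC -dot_Bexp dotC.
(* Of the four terms, the two in which [H] stands next to [Phi] produce [E0]; the other two are the
   energies of [Gamma] and [Delta]. *)
have dc : comm_B (H * A ^+ M - A ^+ M * H) =
    (dot Gamma (H *m Gamma) - E0 * dot Gamma Gamma) +
    (dot Delta (H *m Delta) - E0 * dot Delta Delta).
  rewrite /comm_B /phi mulmxBl !mulv !mulmxBl !mulv HPhi -!scalemxAr.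
  rewrite mulmxBr -scalemxAr !dotBr !dotZr.
  rewrite -/Delta -/Gamma -(Hsa Phi) HPhi dotZl !(Aexp Phi).
  rewrite !(dot_Bexp _ Phi) -/Gamma -/Delta.
  by ring.
move: sumB; rewrite dc => sumB.
have := low Delta; rewrite -subr_ge0 => D0.
have WE : dot Gamma Gamma = W by rewrite /W norm_sqr.
set S := _ * (_ * beta) in sumB.
rewrite (_ : (E0 + _) * _ = E0 * dot Gamma Gamma + S).
  by rewrite addrC -lerBlDr (le_trans _ sumB) // lerDl.
by rewrite /S /beta /G WE; ring.
Qed.

End LocalOperators.
End NormGrowth.
End Tower.

(** * Local operators *)

Section DisjointSupports.
Variables (R : realType) (X : finType) (n : nat).
Local Notation restrict S s := [ffun x : {x : X | x \in S} => s (val x)].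

(** Only one intermediate configuration contributes: it equals [t] on [S] and [s] elsewhere. The
    resulting formula is symmetric in the two operators, whence [acts_on_comm]. *)
Lemma mul_extend_op (S T : {set X}) B B' i j :
  [disjoint S & T] ->
  let s := enum_val i : config X n in let t := enum_val j : config X n in
  (@extend_op R X n S B *m @extend_op R X n T B') i j =
    if [forall x, (x \notin S :|: T) ==> (s x == t x)]
    then entry B (restrict S s) (restrict S t) *
         entry B' (restrict T s) (restrict T t) else 0.
Proof.
move=> dST s t.
have notT x : x \in S -> x \notin T by move=> xS; rewrite (disjointFr dST).
pose u : config X n := [ffun x => if x \in S then t x else s x].
rewrite mxE (bigD1 (enum_rank u)) //= big1 ?addr0 => [|k ku].
  rewrite !mxE !enum_rankK -/s -/t.
  have -> : [forall x, (x \notin S) ==> (s x == u x)].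
    by apply/forallP => x; apply/implyP => xS; rewrite ffunE (negPf xS).
  have -> : [forall x, (x \notin T) ==> (u x == t x)] =
      [forall x, (x \notin S :|: T) ==> (s x == t x)].
    apply: eq_forallb => x; rewrite ffunE inE negb_or.
    by case: (boolP (x \in S)) => [/notT ->|_] //=; rewrite eqxx.
  case: ifP => _; last by rewrite mulr0.
  congr (entry B _ _ * entry B' _ _); apply/ffunP => x; rewrite !ffunE.
    by rewrite (valP x).
  by rewrite (disjointFl dST (valP x)).
rewrite !mxE -/s -/t; case: ifP => [/forallP sk|_]; last by rewrite mul0r.
case: ifP => [/forallP kt|_]; last by rewrite mulr0.
case/eqP: ku; apply: enum_val_inj; rewrite enum_rankK; apply/ffunP => x.
rewrite ffunE; case: ifP => xS.
  by have /implyP/(_ (notT _ xS))/eqP := kt x.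
by have := sk x; rewrite xS /= => /eqP.
Qed.

Lemma acts_on_comm (S T : {set X}) (P Q : op R X n) :
  [disjoint S & T] -> acts_on S P -> acts_on T Q -> P *m Q = Q *m P.
Proof.
move=> dST [B ->] [B' ->]; apply/matrixP => i j.
rewrite !mul_extend_op // 1?disjoint_sym //.
rewrite finset.setUC; case: ifP => // _; exact: mulrC.
Qed.
End DisjointSupports.

(** * Norm bounds for commutators with sums of on-site operators *)

Section LocalObservables.
Variables (R : realType) (K : numClosedFieldType) (N : nat).
Local Notation Op := 'M[K]_N.
Variable norm : 'cV[K]_N -> R.
Hypothesis normD : forall u v, norm (u + v) <= norm u + norm v.
Hypothesis normN : forall u, norm (- u) = norm u.
Hypothesis norm0 : norm 0 = 0.
Hypothesis norm_ge0 : forall u, 0 <= norm u.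

Definition op_bounded (r : R) (P : Op) : Prop :=
  forall v, norm (P *m v) <= r * norm v.

Lemma op_boundedM r s P Q : 0 <= r ->
  op_bounded r P -> op_bounded s Q -> op_bounded (r * s) (P * Q).
Proof.
move=> r0 rP sQ v; rewrite -mulmxA; apply: le_trans (rP _) _.
by rewrite -mulrA ler_wpM2l.
Qed.

Lemma op_boundedB r s P Q :
  op_bounded r P -> op_bounded s Q -> op_bounded (r + s) (P - Q).
Proof.
move=> rP sQ v; rewrite mulmxBl mulrDl; apply: le_trans (normD _ _) _.
by rewrite normN lerD.
Qed.

Lemma op_bounded_sum (X : finType) (S : {set X}) r (F : X -> Op) :
  (forall x, op_bounded r (F x)) ->
  op_bounded (#|S|%:R * r) (\sum_(x in S) F x).
Proof.
move=> rF v; rewrite mulmx_suml -mulrA -sum1_card natr_sum mulr_suml.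
elim/big_rec2: _ => [|x y1 y2 _ IH]; first by rewrite norm0.
by apply: le_trans (normD _ _) _; rewrite lerD ?mul1r ?IH ?rF.
Qed.

Variables (X : finType) (a b : X -> Op) (o : R) (zeta : nat).
Hypothesis o_ge0 : 0 <= o.
Hypothesis a_bounded : forall x, op_bounded o (a x).
Hypothesis b_bounded : forall x, op_bounded o (b x).
Hypothesis comm_aa : forall x y, x != y -> GRing.comm (a x) (a y).
Hypothesis comm_ab : forall x y, x != y -> GRing.comm (a x) (b y).
Hypothesis comm_bb : forall x y, x != y -> GRing.comm (b x) (b y).

(* Locality is recorded through the commutant of the order operators. *)
Definition local_op (r : R) (P : Op) : Prop :=
  [/\ 0 <= r, op_bounded r P &
      exists2 S : {set X}, (#|S| <= zeta)%N &
        forall y, y \notin S -> GRing.comm (a y) P /\ GRing.comm (b y) P].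

(** Only the at most [zeta] sites of [S] contribute, each at most 2 o r. The explicit sum is kept to
    control the support of the commutator. *)
Lemma comm_sum_local (c : X -> Op) r P (S : {set X}) :
  (forall x, op_bounded o (c x)) -> 0 <= r -> op_bounded r P ->
  (#|S| <= zeta)%N -> (forall y, y \notin S -> GRing.comm (c y) P) ->
  (\sum_y c y) * P - P * (\sum_y c y) = \sum_(y in S) (c y * P - P * c y) /\
  op_bounded (2 * zeta%:R * o * r) ((\sum_y c y) * P - P * (\sum_y c y)).
Proof.
move=> oc r0 rP Sz cP.
have E : (\sum_y c y) * P - P * (\sum_y c y) = \sum_(y in S) (c y * P - P * c y).
  rewrite mulr_suml mulr_sumr -sumrB [RHS]big_mkcond /=; apply: eq_bigr => y _.
  by case: ifPn => // /cP ->; rewrite subrr.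
split=> //; rewrite E => v.
have bound y : op_bounded (2 * o * r) (c y * P - P * c y).
  rewrite (_ : 2 * o * r = o * r + r * o); last by ring.
  by apply: op_boundedB; apply: op_boundedM.
apply: le_trans (op_bounded_sum S bound v) _.
rewrite ler_wpM2r // (_ : 2 * _ * o * r = zeta%:R * (2 * o * r)); last by ring.
by rewrite ler_wpM2r ?ler_nat // !mulr_ge0.
Qed.

(** The order operators act on single sites, so the commutator is still supported on the same [S].
    Hence the factor 2 zeta o does not grow under iteration. *)
Lemma local_comm_a r P : local_op r P ->
  local_op (2 * zeta%:R * o * r) ((\sum_y a y) * P - P * (\sum_y a y)).
Proof.
case=> r0 rP [S Sz SP].
have [E bd] := comm_sum_local a_bounded r0 rP Sz (fun y yS => (SP y yS).1).
split=> //; first by rewrite !mulr_ge0.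
exists S => // z zS; have [az bz] := SP z zS; rewrite E.
split; apply: commr_sum => y yS; have yz : z != y by apply: contraNneq zS => ->.
  by apply: commrB; apply: commrM => //; apply: comm_aa.
apply: commrB; apply: commrM => //; apply/commr_sym/comm_ab; by rewrite eq_sym.
Qed.

Lemma local_comm_b r P : local_op r P ->
  local_op (2 * zeta%:R * o * r) ((\sum_y b y) * P - P * (\sum_y b y)).
Proof.
case=> r0 rP [S Sz SP].
have [E bd] := comm_sum_local b_bounded r0 rP Sz (fun y yS => (SP y yS).2).
split=> //; first by rewrite !mulr_ge0.
exists S => // z zS; have [az bz] := SP z zS; rewrite E.
split; apply: commr_sum => y yS; have yz : z != y by apply: contraNneq zS => ->.
  by apply: commrB; apply: commrM => //; apply: comm_ab.
by apply: commrB; apply: commrM => //; apply: comm_bb.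
Qed.

Lemma comm_order_bounded :
  op_bounded (#|X|%:R * (2 * o ^+ 2))
    ((\sum_y a y) * (\sum_y b y) - (\sum_y b y) * (\sum_y a y)).
Proof.
have -> : (\sum_y a y) * (\sum_y b y) - (\sum_y b y) * (\sum_y a y) =
    \sum_(y in [set: X]) (a y * b y - b y * a y).
  rewrite mulr_suml mulr_sumr -sumrB [RHS](eq_bigl xpredT) => [|y];
    last by rewrite inE.
  apply: eq_bigr => y _; rewrite mulr_sumr mulr_suml -sumrB.
  rewrite (bigD1 y) //= big1 ?addr0 // => z zy.
  by rewrite (comm_ab (x := y) (y := z)) ?subrr // eq_sym.
rewrite -cardsT; apply: op_bounded_sum => y v.
rewrite (_ : 2 * o ^+ 2 = o * o + o * o); last by ring.
by apply: op_boundedB; apply: op_boundedM.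
Qed.
End LocalObservables.

(** * Numerical constants *)

Section Constants.
Variables (R : realType) (o h q : R) (zeta : nat).
Hypothesis q_gt0 : 0 < q.
Hypothesis o_ge0 : 0 <= o.
Hypothesis h_ge0 : 0 <= h.
Let s := zeta%:R * o.

(** The three bounds serve [M_sqr_leV], [swaps_le] and [Mt_le] respectively. The 1 added to [o ^+ 2]
    absorbs M <= V in [kappa]; the one added to 4 s avoids a zero denominator. *)
Definition max_charge : R :=
  Num.min 1 (Num.min (q / (4 * (o ^+ 2 + 1))) (Num.sqrt q / (4 * s + 1))).
(** The last two terms here and in [cubic_const] come from the local commutators and from the swaps;
    the leading 1 ensures positivity even if [h] vanishes. *)
Definition quadratic_const : R :=
  1 + 16 * h * s ^+ 2 / q + 32 * h * s / (q * Num.sqrt q).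
Definition cubic_const : R :=
  1 + 16 * h * s ^+ 2 / q + 32 * h * s * (o ^+ 2 + 1) / (q * Num.sqrt q).

Lemma s_ge0 : 0 <= s. Proof. exact: mulr_ge0. Qed.

Lemma sqrtq_gt0 : 0 < Num.sqrt q. Proof. by rewrite sqrtr_gt0. Qed.

Lemma o2_gt0 : 0 < o ^+ 2 + 1. Proof. by rewrite ltr_wpDl // sqr_ge0. Qed.

Lemma max_charge_gt0 : 0 < max_charge.
Proof.
rewrite !lt_min ltr01 !divr_gt0 ?sqrtq_gt0 //.
  by rewrite ltr_wpDl // mulr_ge0 // s_ge0.
by rewrite mulr_gt0 // o2_gt0.
Qed.

Lemma quadratic_const_gt0 : 0 < quadratic_const.
Proof.
have q32 := ltW (mulr_gt0 q_gt0 sqrtq_gt0).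
have s0 := s_ge0; have q0 := ltW q_gt0.
rewrite /quadratic_const -addrA ltr_wpDr // addr_ge0 // divr_ge0 //.
  by rewrite !mulr_ge0 // sqr_ge0.
by rewrite !mulr_ge0.
Qed.

Lemma cubic_const_gt0 : 0 < cubic_const.
Proof.
have q32 := ltW (mulr_gt0 q_gt0 sqrtq_gt0).
have s0 := s_ge0; have q0 := ltW q_gt0.
have o2 := ltW o2_gt0.
rewrite /cubic_const -addrA ltr_wpDr // addr_ge0 // divr_ge0 //.
  by rewrite !mulr_ge0 // sqr_ge0.
by rewrite !mulr_ge0.
Qed.

Variables (V mu : R) (M : nat).
Hypothesis V_gt0 : 0 < V.
Hypothesis M_gt0 : (0 < M)%N.
Hypothesis M_le : M%:R <= max_charge * Num.sqrt V.
Hypothesis mu_le : `|mu| <= o ^+ 2 * V.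
Let kappa := 2 * (`|mu| + M%:R).
Let tau := (Num.sqrt q * V)^-1.
Let t := 2 * zeta%:R * o * tau.
(** The error term of [tower_energy] for Q = q V^2 and [V] sites. *)
Definition energy_excess : R := V * (h * ((1 + t) ^+ M) ^+ 2 *
  (M%:R * t) * (M%:R * t + M%:R * (2 * M%:R * kappa * tau ^+ 2))).

Let V_ge0 : 0 <= V := ltW V_gt0.
Let q_ge0 : 0 <= q := ltW q_gt0.
Let C1_ge0 : 0 <= max_charge := ltW max_charge_gt0.

Let C1_le1 : max_charge <= 1. Proof. by rewrite ge_min lexx. Qed.

Let C1_q : 4 * max_charge * (o ^+ 2 + 1) <= q.
Proof.
have : max_charge <= q / (4 * (o ^+ 2 + 1)) by rewrite !ge_min lexx orbT.
rewrite ler_pdivlMr ?mulr_gt0 ?o2_gt0 //; lra.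
Qed.

Let C1_sqrtq : 4 * s * max_charge <= Num.sqrt q.
Proof.
have : max_charge <= Num.sqrt q / (4 * s + 1) by rewrite !ge_min lexx !orbT.
rewrite ler_pdivlMr; last by rewrite ltr_wpDl // mulr_ge0 // s_ge0.
by have := max_charge_gt0; lra.
Qed.

Let M_ge1 : 1 <= M%:R :> R. Proof. by rewrite ler1n. Qed.

Lemma tau_pos : 0 < tau.
Proof. by rewrite invr_gt0 mulr_gt0 // sqrtq_gt0. Qed.

Lemma tau_sqr : tau ^+ 2 = (q * V ^+ 2)^-1.
Proof. by rewrite exprVn exprMn sqr_sqrtr. Qed.

Lemma M_sqr_le : M%:R ^+ 2 <= max_charge * V.
Proof.
have : M%:R ^+ 2 <= (max_charge * Num.sqrt V) ^+ 2.
  by rewrite ler_sqr ?nnegrE // mulr_ge0 ?sqrtr_ge0.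
rewrite exprMn sqr_sqrtr // => /le_trans; apply.
by rewrite ler_wpM2r // expr2 ler_piMr.
Qed.

Lemma M_le_sqr : M%:R <= M%:R ^+ 2 :> R.
Proof. by rewrite expr2 ler_peMl. Qed.

Lemma M_sqr_leV : M%:R ^+ 2 <= V.
Proof. by apply: le_trans M_sqr_le _; rewrite ler_piMl. Qed.

Lemma kappa_le : kappa <= 2 * (o ^+ 2 + 1) * V.
Proof.
have := le_trans M_le_sqr M_sqr_leV; rewrite /kappa.
by move: mu_le; move: `|mu| => x; lra.
Qed.

Lemma swaps_le : 2 * M%:R * (M%:R * kappa) <= q * V ^+ 2.
Proof.
have k0 : 0 <= kappa by rewrite mulr_ge0 // addr_ge0.
rewrite (_ : 2 * _ * _ = 2 * (M%:R ^+ 2 * kappa)); last by ring.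
have := ler_pM (sqr_ge0 _) k0 M_sqr_le kappa_le.
have := ler_wpM2r (sqr_ge0 V) C1_q; lra.
Qed.

Lemma swaps_tau : 2 * M%:R * (M%:R * kappa) * tau ^+ 2 <= 1.
Proof.
rewrite tau_sqr ler_pdivrMr ?mul1r ?swaps_le //.
by rewrite mulr_gt0 ?exprn_gt0.
Qed.

Lemma Mkappa_le : M%:R * kappa <= q * V ^+ 2.
Proof.
apply: le_trans swaps_le; rewrite ler_peMl ?mulr_ge0 ?addr_ge0 //.
by have := M_ge1; lra.
Qed.

Lemma Mt_le : M%:R * t <= 2^-1.
Proof.
have VS : 0 < Num.sqrt q * V by rewrite mulr_gt0 // sqrtq_gt0.
rewrite /t mulrA ler_pdivrMr //.
have := le_trans M_le_sqr M_sqr_le => MV.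
have := ler_wpM2l s_ge0 MV; have := ler_wpM2r V_ge0 C1_sqrtq.
rewrite /s; lra.
Qed.

(** While k t <= 1/2, induction gives (1 + t)^k <= 1 + 2 k t. *)
Lemma growth_le2 : (1 + t) ^+ M <= 2.
Proof.
have t0 : 0 <= t by rewrite !mulr_ge0 // ltW // tau_pos.
have H k : (k <= M)%N -> (1 + t) ^+ k <= 1 + 2 * k%:R * t.
  elim: k => [|k IH] kM; first by rewrite expr0 mulr0 mul0r addr0.
  rewrite exprSr; apply: le_trans (ler_wpM2r _ (IH (ltnW kM))) _.
    by rewrite addr_ge0.
  have kt : k%:R * t <= 2^-1.
    apply: le_trans Mt_le; rewrite ler_wpM2r // ler_nat; exact: ltnW.
  rewrite -(natr1 k); have := ler_wpM2r t0 kt; lra.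
apply: le_trans (H M (leqnn M)) _; have := Mt_le; lra.
Qed.

(** The squared growth factor is at most 4 and t = 2 s tau; the two summands are the (M t)^2 term
    and the swap term. *)
Let excess_le : energy_excess <= 16 * h * s ^+ 2 / q * (M%:R ^+ 2 / V) +
  16 * h * s / (q * Num.sqrt q) * (M%:R ^+ 3 * kappa / V ^+ 2).
Proof.
have k0 : 0 <= kappa by rewrite mulr_ge0 // addr_ge0.
have t0 : 0 <= t by rewrite !mulr_ge0 // ltW // tau_pos.
have g2 : ((1 + t) ^+ M) ^+ 2 <= 4.
  rewrite (_ : 4 = 2 ^+ 2); last by ring.
  rewrite ler_sqr ?nnegrE ?growth_le2 //; by rewrite exprn_ge0 // addr_ge0.
rewrite (_ : _ + _ = V * (h * 4 * (M%:R * t) *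
    (M%:R * t + M%:R * (2 * M%:R * kappa * tau ^+ 2)))); last first.
  rewrite tau_sqr /t /tau /s.
  have := sqr_sqrtr q_ge0; have := sqrtq_gt0.
  move: (Num.sqrt q) => r r0 <-; field.
  by rewrite !gt_eqF.
rewrite /energy_excess ler_wpM2l // ler_wpM2r //.
  have M0 : 0 <= M%:R :> R by exact: ler0n.
  apply: addr_ge0 (mulr_ge0 M0 t0) (mulr_ge0 M0 _).
  exact: (mulr_ge0 (mulr_ge0 (mulr_ge0 _ M0) k0) (sqr_ge0 _)).
exact: (ler_wpM2r (mulr_ge0 (ler0n _ _) t0) (ler_wpM2l h_ge0 g2)).
Qed.

(** The charge may be of order [V], so only [kappa_le] is available in the swap term; the other term
    is weakened by M^2 <= M^3. *)
Lemma excess_cubic : energy_excess <= cubic_const * M%:R ^+ 3 / V.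
Proof.
apply: le_trans excess_le _.
have q32 : 0 < q * Num.sqrt q by rewrite mulr_gt0 // sqrtq_gt0.
have c2 : 0 <= 16 * h * s ^+ 2 / q.
  by rewrite divr_ge0 // !mulr_ge0 // ?sqr_ge0.
have c3 : 0 <= 16 * h * s / (q * Num.sqrt q).
  by rewrite divr_ge0 ?(ltW q32) // !mulr_ge0.
have M23 : M%:R ^+ 2 / V <= M%:R ^+ 3 / V.
  by rewrite ler_wpM2r ?invr_ge0 // [M%:R ^+ 3]exprSr ler_peMr // sqr_ge0.
have M3 : 0 <= M%:R ^+ 3 / V by rewrite divr_ge0 ?exprn_ge0.
have k3 : M%:R ^+ 3 * kappa / V ^+ 2 <= 2 * (o ^+ 2 + 1) * (M%:R ^+ 3 / V).
  rewrite (_ : 2 * _ * _ = M%:R ^+ 3 * (2 * (o ^+ 2 + 1) * V) / V ^+ 2); last first.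
    by field; rewrite gt_eqF.
  by rewrite ler_wpM2r ?invr_ge0 ?sqr_ge0 // ler_wpM2l ?exprn_ge0 ?kappa_le.
have := ler_wpM2l c2 M23; have := ler_wpM2l c3 k3.
rewrite /cubic_const; move: c2 c3 M3 {k3 M23}.
move: (16 * h * s ^+ 2 / q) => x.
rewrite (_ : 32 * h * s * (o ^+ 2 + 1) / _ =
  16 * h * s / (q * Num.sqrt q) * (2 * (o ^+ 2 + 1))); last first.
  by field; rewrite !gt_eqF ?sqrtq_gt0.
move: (16 * h * s / _) => y; rewrite -(mulrA _ (M%:R ^+ 3)).
move: (M%:R ^+ 3 / V) (M%:R ^+ 2 / V) (M%:R ^+ 3 * kappa / V ^+ 2) => z u w.
by move: (o ^+ 2 + 1) => o2; lra.
Qed.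

(** Without ground state charge, kappa = 2 M, and the swap term is of order M^4 / V^2 <= M^2 / V. *)
Lemma excess_quadratic : mu = 0 -> energy_excess <= quadratic_const * M%:R ^+ 2 / V.
Proof.
move=> mu0; apply: le_trans excess_le _.
have q32 : 0 < q * Num.sqrt q by rewrite mulr_gt0 // sqrtq_gt0.
have c3 : 0 <= 16 * h * s / (q * Num.sqrt q).
  by rewrite divr_ge0 ?(ltW q32) // !mulr_ge0.
have M2 : 0 <= M%:R ^+ 2 / V by rewrite divr_ge0 ?sqr_ge0.
have k3 : M%:R ^+ 3 * kappa / V ^+ 2 <= 2 * (M%:R ^+ 2 / V).
  rewrite (_ : M%:R ^+ 3 * kappa / V ^+ 2 =
    2 * (M%:R ^+ 2 / V) * (M%:R ^+ 2 / V)); last first.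
    by rewrite /kappa mu0 normr0; field; rewrite gt_eqF.
  have r1 : M%:R ^+ 2 / V <= 1 by rewrite ler_pdivrMr // mul1r M_sqr_leV.
  by apply: ler_piMr r1; apply: mulr_ge0.
have := ler_wpM2l c3 k3.
rewrite /quadratic_const; move: c3 M2 {k3}.
move: (16 * h * s ^+ 2 / q) => x.
rewrite (_ : 32 * h * s / _ = 16 * h * s / (q * Num.sqrt q) * 2); last first.
  by field; rewrite !gt_eqF ?sqrtq_gt0.
move: (16 * h * s / _) => y; rewrite -(mulrA _ (M%:R ^+ 2)).
by move: (M%:R ^+ 2 / V) (M%:R ^+ 3 * kappa / V ^+ 2) => z u; lra.
Qed.
End Constants.

(** * Tower states of a local Hamiltonian *)

Section LocalTower.
Variables (R : realType) (K : numClosedFieldType) (N : nat).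
Variables (emb : {rmorphism R -> K}) (dot : 'cV[K]_N -> 'cV[K]_N -> R).
Hypothesis dotC : forall u v, dot u v = dot v u.
Hypothesis dotDr : forall u v w, dot u (v + w) = dot u v + dot u w.
Hypothesis dotNr : forall u v, dot u (- v) = - dot u v.
Hypothesis dotZr : forall c u v, dot u (emb c *: v) = c * dot u v.
Hypothesis dot_ge0 : forall u, 0 <= dot u u.
Let norm u := Num.sqrt (dot u u).
Hypothesis dot_CS : forall u v, `|dot u v| <= norm u * norm v.
Hypothesis normD : forall u v, norm (u + v) <= norm u + norm v.

Variables (X : finType) (hl a b : X -> 'M[K]_N) (C : 'M[K]_N).
Variables (Phi : 'cV[K]_N) (mu E0 o h q : R) (zeta M : nat).
Let A := \sum_x a x.
Let B := \sum_x b x.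
Let H := \sum_x hl x.
Let V : R := #|X|%:R.
Hypothesis dot_B : forall u v, dot u (B *m v) = dot (A *m u) v.
Hypothesis commAB : A * B - B * A = C *+ 2.
Hypothesis commCA : C * A - A * C = A.
Hypothesis commCB : C * B - B * C = - B.
Hypothesis CPhi : C *m Phi = emb mu *: Phi.
Hypothesis Phi1 : dot Phi Phi = 1.
Hypothesis H_adj : forall u v, dot (H *m u) v = dot u (H *m v).
Hypothesis HPhi : H *m Phi = emb E0 *: Phi.
Hypothesis H_ge : forall v, E0 * dot v v <= dot v (H *m v).
Hypothesis a_bounded : forall x, op_bounded norm o (a x).
Hypothesis b_bounded : forall x, op_bounded norm o (b x).
Hypothesis comm_aa : forall x y, x != y -> GRing.comm (a x) (a y).
Hypothesis comm_ab : forall x y, x != y -> GRing.comm (a x) (b y).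
Hypothesis comm_bb : forall x y, x != y -> GRing.comm (b x) (b y).
Hypothesis o_ge0 : 0 <= o.
Hypothesis hl_local : forall x, local_op norm a b zeta h (hl x).
Hypothesis h_ge0 : 0 <= h.
Hypothesis q_gt0 : 0 < q.
Hypothesis V_gt0 : 0 < V.
Hypothesis order : 2 * (q * V ^+ 2) - mu <= dot (A *m Phi) (A *m Phi).
Hypothesis M_gt0 : (0 < M)%N.
Hypothesis M_le : M%:R <= max_charge o q zeta * Num.sqrt V.

Let nrm_ge0 u : 0 <= norm u. Proof. exact: sqrtr_ge0. Qed.
Let nrmN u : norm (- u) = norm u.
Proof. by rewrite /norm dotNr dotC dotNr opprK. Qed.
Let nrm0 : norm 0 = 0.
Proof. by rewrite /norm (dot0r dotDr dotNr) sqrtr0. Qed.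

(* 2 C is the sum of the on-site commutators. *)
Lemma charge_le : `|mu| <= o ^+ 2 * V.
Proof.
have := comm_order_bounded normD nrmN nrm0 o_ge0 a_bounded b_bounded
  comm_ab Phi.
rewrite -/A -/B commAB -scaler_nat -scalemxAl CPhi scalerA.
rewrite -(rmorph_nat emb) -rmorphM /norm dotZr dotC dotZr Phi1 sqrtr1 !mulr1.
rewrite -expr2 sqrtr_sqr normrM normr_nat -/V => le2.
have := le2; move: (o ^+ 2) `|mu| V => x y z; lra.
Qed.

Lemma tower_charge : C *m (A ^+ M *m Phi) = emb (mu + M%:R) *: (A ^+ M *m Phi).
Proof. exact: charge_Aexp commCA _ _ _ CPhi. Qed.

Let Q_gt0 : 0 < q * V ^+ 2. Proof. by rewrite mulr_gt0 // exprn_gt0. Qed.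

Lemma local_tower_gt0 : 0 < dot (A ^+ M *m Phi) (A ^+ M *m Phi).
Proof.
exact: (tower_gt0 dotC dotDr dotNr dotZr dot_ge0 dot_CS dot_B commAB commCA CPhi
  Phi1 (lexx _) (Mkappa_le q_gt0 o_ge0 V_gt0 M_gt0 M_le charge_le) order Q_gt0
  M_gt0).
Qed.

Lemma local_tower_energy :
  dot (A ^+ M *m Phi) (H *m (A ^+ M *m Phi)) <=
    (E0 + energy_excess o h q zeta V mu M) * dot (A ^+ M *m Phi) (A ^+ M *m Phi).
Proof.
(* Here Q = q V^2 and tau = 1 / sqrt Q. *)
have tQ : (Num.sqrt q * V)^-1 ^+ 2 * (q * V ^+ 2) = 1.
  by rewrite tau_sqr // mulVf // gt_eqF.
have s2_ge0 : 0 <= 2 * zeta%:R * o by rewrite !mulr_ge0.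
have := tower_energy dotC dotDr dotNr dotZr dot_ge0 dot_CS dot_B commAB
  commCA commCB CPhi Phi1 (lexx _)
  (Mkappa_le q_gt0 o_ge0 V_gt0 M_gt0 M_le charge_le) order Q_gt0
  (tau_pos q_gt0 V_gt0) tQ s2_ge0
  (loc := local_op norm a b zeta) _ _
  (local_comm_a normD nrmN nrm0 nrm_ge0 o_ge0 a_bounded comm_aa comm_ab)
  (local_comm_b normD nrmN nrm0 nrm_ge0 o_ge0 b_bounded comm_ab comm_bb)
  (swaps_tau q_gt0 o_ge0 V_gt0 M_gt0 M_le charge_le) erefl H_adj HPhi H_ge hl_local.
apply.
- by move=> r P [].
- by move=> r P v [_ rP _]; apply: rP.
Qed.
End LocalTower.

(** * Ladder operators *)

Section Ladder.
Variables (K : numClosedFieldType) (N : nat) (ii : K).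
Hypothesis ii2 : ii * ii = -1.
Variables O1 O2 C : 'M[K]_N.
Hypothesis O1C : O1 *m C - C *m O1 = - ii *: O2.
Hypothesis O2C : O2 *m C - C *m O2 = ii *: O1.
Hypothesis O12 : O1 *m O2 - O2 *m O1 = ii *: C.
Let A := O1 + ii *: O2.
Let B := O1 - ii *: O2.

Lemma raise_lower : A * B = O1 * O1 + O2 * O2 + C.
Proof.
rewrite /A /B -[LHS]/(_ *m _) mulmxDl !mulmxBr -!scalemxAl -!scalemxAr !scalerA.
rewrite ii2 scaleN1r opprK [ii *: _ + _]addrC addrACA; congr (_ + _).
by rewrite addrC -scalerBr -opprB O12 scalerN scalerA ii2 scaleN1r opprK.
Qed.

Lemma lower_raise : B * A = O1 * O1 + O2 * O2 - C.
Proof.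
rewrite /A /B -[LHS]/(_ *m _) mulmxBl !mulmxDr -!scalemxAl -!scalemxAr !scalerA.
rewrite ii2 scaleN1r opprD opprK [- _ + _]addrC addrACA; congr (_ + _).
by rewrite -scalerBr O12 scalerA ii2 scaleN1r.
Qed.

Lemma comm_ladder : A * B - B * A = C *+ 2.
Proof. by rewrite raise_lower lower_raise opprD opprK addrACA subrr add0r mulr2n. Qed.

Let CO1 : C *m O1 - O1 *m C = ii *: O2.
Proof. by rewrite -opprB O1C scaleNr opprK. Qed.

Let CO2 : C *m O2 - O2 *m C = - (ii *: O1).
Proof. by rewrite -opprB O2C. Qed.

Lemma comm_charge_raise : C * A - A * C = A.
Proof.
rewrite -[LHS]/(_ *m _ - _ *m _) /A mulmxDr mulmxDl -scalemxAl -scalemxAr.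
rewrite opprD addrACA -scalerBr CO1 CO2.
by rewrite scalerN scalerA ii2 scaleN1r opprK addrC.
Qed.

Lemma comm_charge_lower : C * B - B * C = - B.
Proof.
rewrite -[LHS]/(_ *m _ - _ *m _) /B mulmxBr mulmxBl -scalemxAl -scalemxAr.
rewrite opprD addrACA -opprD -scalerBr CO1 CO2.
by rewrite scalerN scalerA ii2 scaleN1r !opprK opprB.
Qed.
End Ladder.

Lemma comm_ladder_site (K : numClosedFieldType) N (P P' Q Q' : 'M[K]_N) c c' :
  GRing.comm P Q -> GRing.comm P Q' -> GRing.comm P' Q -> GRing.comm P' Q' ->
  GRing.comm (P + c *: P') (Q + c' *: Q').
Proof.
rewrite /GRing.comm -![_ * _]/(_ *m _) => e1 e2 e3 e4.
rewrite !mulmxDl !mulmxDr -!scalemxAl -!scalemxAr e1 e2 e3 e4.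
by rewrite !scalerA (mulrC c c') addrACA.
Qed.

(** * From the trial state to an eigenvector of the same charge *)

Section SectorEigenvector.
Variables (R : realType) (X : finType) (N : nat).
Let K : numClosedFieldType := R[i].
Variables (hl a b : X -> 'M[K]_N) (C : 'M[K]_N) (Phi : 'cV[K]_N).
Variables (mu E0 o h q : R) (zeta M : nat).
Let A := \sum_x a x.
Let B := \sum_x b x.
Let H := \sum_x hl x.
Let V : R := #|X|%:R.

(** Everything is abstract in [a], [b] and [C], so that negative charges are covered by exchanging
    [a] with [b] and negating [C]. *)
Lemma sector_eigenvector :
  B = A^t* ->
  A * B - B * A = C *+ 2 -> C * A - A * C = A -> C * B - B * C = - B ->
  C *m Phi = (mu%:C : K) *: Phi -> rdot Phi Phi = 1 ->
  selfadjoint H -> lowest_eigenvalue H E0 -> H *m Phi = (E0%:C : K) *: Phi ->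
  C *m H = H *m C ->
  (forall x, op_bounded (@vnorm R N) o (a x)) ->
  (forall x, op_bounded (@vnorm R N) o (b x)) ->
  (forall x y, x != y -> GRing.comm (a x) (a y)) ->
  (forall x y, x != y -> GRing.comm (a x) (b y)) ->
  (forall x y, x != y -> GRing.comm (b x) (b y)) ->
  0 <= o -> (forall x, local_op (@vnorm R N) a b zeta h (hl x)) -> 0 <= h ->
  0 < q -> 0 < V ->
  2 * (q * V ^+ 2) - mu <= rdot (A *m Phi) (A *m Phi) ->
  (0 < M)%N -> M%:R <= max_charge o q zeta * Num.sqrt V ->
  exists Psi E, [/\ eigenvec H E Psi, C *m Psi = (mu + M%:R)%:C *: Psi,
    E <= E0 + cubic_const o h q zeta * M%:R ^+ 3 / V &
    mu = 0 -> E <= E0 + quadratic_const o h q zeta * M%:R ^+ 2 / V].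
Proof.
move=> BA cAB cCA cCB CPhi Phi1 Hsa low HPhi CH abd bbd caa cab cbb o0 hloc h0.
move=> q0 V0 ord M0 Mle.
have dot_B u v : rdot u (B *m v) = rdot (A *m u) v.
  by rewrite BA rdotC rdot_adj rdotC.
have H_adj u v : rdot (H *m u) v = rdot u (H *m v).
  by rewrite -[in LHS]Hsa rdot_adj.
have mule := charge_le (emb := real_complex R) (@rdotC R N) (@rdotDr R N)
  (@rdotNr R N) (@rdotZr R N) (@vnormD R N) cAB CPhi Phi1 abd bbd cab o0.
have gt0 := local_tower_gt0 (emb := real_complex R) (@rdotC R N) (@rdotDr R N)
  (@rdotNr R N) (@rdotZr R N) (@rdot_ge0 R N) (@CauchySchwarz_rdot R N)
  (@vnormD R N) dot_B cAB cCA CPhi Phi1 abd bbd cab o0 q0 V0 ord M0 Mle.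
have en := local_tower_energy (emb := real_complex R) (@rdotC R N)
  (@rdotDr R N) (@rdotNr R N) (@rdotZr R N) (@rdot_ge0 R N) (@CauchySchwarz_rdot R N)
  (@vnormD R N) dot_B cAB cCA cCB CPhi Phi1 H_adj
  HPhi (fun v => lowest_eigenvalue_le v Hsa low)
  abd bbd caa cab cbb o0 hloc q0 V0 ord M0 Mle.
have ch := tower_charge (emb := real_complex R) M cCA CPhi.
have G0 : A ^+ M *m Phi != 0 by rewrite -rdot_eq0 gt_eqF.
have [Psi [E [HE CE Ele]]] := commuting_eigenvector Hsa CH G0 ch en.
exists Psi, E; split=> //.
  apply: le_trans Ele _; rewrite lerD2l; exact: excess_cubic.
move=> mu0; apply: le_trans Ele _; rewrite lerD2l; exact: excess_quadratic.
Qed.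
End SectorEigenvector.

(** * Adjoints of ladder operators and expectations of order densities *)

Section LadderOperators.
Variables (R : realType) (X : finType) (N : nat).
Let K : numClosedFieldType := R[i].
Implicit Types P Q : 'M[K]_N.

Lemma adj_ladder P Q : selfadjoint P -> selfadjoint Q ->
  (P + ('i%C : K) *: Q)^t* = P - ('i%C : K) *: Q.
Proof.
move=> Psa Qsa.
have adjZ (c : K) : (c *: Q)^t* = (Num.conj c) *: Q.
  by rewrite -[in RHS]Qsa; apply/matrixP => i j; rewrite !mxE rmorphM.
have conji : Num.conj ('i%C : K) = - ('i%C : K).
  by rewrite conjCE /=; apply/eqP; rewrite eq_complex /= oppr0 !eqxx.
by rewrite linearD /= map_mxD adjZ Psa conji scaleNr.
Qed.

Lemma Re_expval_density (v : R) (O : 'M[R[i]]_N) (Phi : 'cV[R[i]]_N) :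
  complex.Re (expval Phi ((v%:C *: O) *m (v%:C *: O))) =
  v ^+ 2 * rdot Phi (O *m O *m Phi).
Proof.
rewrite /expval -scalemxAl -scalemxAr scalerA -rmorphM -scalemxAl.
exact: rdotZr.
Qed.

Lemma expval_density_ge (q v : R) (O : 'M[R[i]]_N) (Phi : 'cV[R[i]]_N) :
  0 < v -> q%:C <= expval Phi ((v^-1%:C *: O) *m (v^-1%:C *: O)) ->
  q * v ^+ 2 <= rdot Phi (O *m O *m Phi).
Proof.
move=> v0; rewrite lecE => /andP[_]; rewrite Re_expval_density.
by move: (rdot _ _) => r /=; rewrite exprVn mulrC ler_pdivlMr ?exprn_gt0.
Qed.
End LadderOperators.

Lemma card_site d L : (1 < L)%N -> #|site d L| = (L ^ d)%N.
Proof. by move=> L1; rewrite card_ffun !card_ord Zp_cast. Qed.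

(** * The lattice model satisfies the abstract hypotheses *)

Section Model.
Variables (R : realType) (d n : nat) (m : model R d n) (a0 o0 h0 q0 : R).
Variables (zeta L : nat).
Hypothesis q0_gt0 : 0 < q0.
Hypothesis L_even : even_size L.
Hypothesis hm : standing_assumptions m a0 o0 h0 zeta q0.

Let K : numClosedFieldType := R[i].
Let X := site d L.
Let N := #|config X n|.
Let ii : K := 'i%C.
Let o1 : X -> 'M[K]_N := @oloc1 _ _ _ m L.
Let o2 : X -> 'M[K]_N := @oloc2 _ _ _ m L.
Let raise x : 'M[K]_N := o1 x + ii *: o2 x.
Let lower x : 'M[K]_N := o1 x - ii *: o2 x.
Let A := \sum_x raise x.
Let B := \sum_x lower x.
Let C : 'M[K]_N := charge m L.
Let H : 'M[K]_N := hamiltonian m L.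
Let Phi : 'cV[K]_N := gs m L.
Let O1 : 'M[K]_N := order1 m L.
Let O2 : 'M[K]_N := order2 m L.
Let V : R := #|X|%:R.

Let ii2 : ii * ii = -1.
Proof. by rewrite -expr2 sqr_i. Qed.

(** Needed for ['Z_L] to have exactly [L] elements. *)
Let L_gt1 : (1 < L)%N.
Proof. by case: L_even; case: L => [|[|]]. Qed.

Lemma volumeE : volume R d L = V.
Proof. by rewrite /V card_site. Qed.

Let V_gt0 : 0 < V.
Proof. by rewrite -volumeE ltr0n expn_gt0 ltnW. Qed.

Lemma sum_raise : A = O1 + ii *: O2.
Proof. by rewrite /A big_split /= scaler_sumr. Qed.

Lemma sum_lower : B = O1 - ii *: O2.
Proof. by rewrite /B sumrB /= scaler_sumr. Qed.

Lemma raise_bounded x : op_bounded (@vnorm R N) o0 (raise x).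
Proof.
move=> v; have [_ _ _ /(_ x)[_ _ _ <- _] _] := hm L_even; exact: opnormP.
Qed.

Lemma lower_bounded x : op_bounded (@vnorm R N) o0 (lower x).
Proof.
move=> v; have [_ _ _ /(_ x)[_ _ _ _ <-] _] := hm L_even; exact: opnormP.
Qed.

Lemma comm_sites x y : x != y ->
  [/\ GRing.comm (o1 x) (o1 y), GRing.comm (o1 x) (o2 y),
      GRing.comm (o2 x) (o1 y) & GRing.comm (o2 x) (o2 y)].
Proof.
move=> xy; have [_ _ _ loc _] := hm L_even.
have [_ [x1 x2] _ _ _] := loc x; have [_ [y1 y2] _ _ _] := loc y.
have dxy : [disjoint [set x]%SET & [set y]%SET] by rewrite disjoints1 inE.
by split; apply: (acts_on_comm dxy).
Qed.

Lemma lowerE y : lower y = o1 y + (- ii) *: o2 y.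
Proof. by rewrite scaleNr. Qed.

Lemma comm_raise x y : x != y -> GRing.comm (raise x) (raise y).
Proof. by move=> /comm_sites[? ? ? ?]; apply: comm_ladder_site. Qed.

Lemma comm_raise_lower x y : x != y -> GRing.comm (raise x) (lower y).
Proof. by rewrite lowerE => /comm_sites[? ? ? ?]; apply: comm_ladder_site. Qed.

Lemma comm_lower x y : x != y -> GRing.comm (lower x) (lower y).
Proof. by rewrite !lowerE => /comm_sites[? ? ? ?]; apply: comm_ladder_site. Qed.

Lemma vnorm_gs : vnorm Phi = 1.
Proof.
by have [_ _ _ _ [[_ gs1 _ _ _] _]] := hm L_even; rewrite /vnorm gs1 /= sqrtr1.
Qed.

Let site0 : X := [ffun _ => 0].

Lemma order_norm_ge0 : 0 <= o0.
Proof.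
have := raise_bounded site0 Phi; rewrite vnorm_gs mulr1; exact/le_trans/vnorm_ge0.
Qed.

Lemma hloc_local x : local_op (@vnorm R N) raise lower zeta h0 (hloc m x).
Proof.
have [_ _ _ loc _] := hm L_even; have [[S [xS Sz hS]] _ hnorm _ _] := loc x.
have hb : op_bounded (@vnorm R N) h0 (hloc m x).
  by move=> v; rewrite -hnorm; apply: opnormP.
split=> //.
  have := hb Phi; rewrite vnorm_gs mulr1; exact/le_trans/vnorm_ge0.
exists S => // y yS; have [_ [y1 y2] _ _ _] := loc y.
have dyS : [disjoint [set y]%SET & S] by rewrite disjoints1.
have c1 : GRing.comm (o1 y) (hloc m x) by apply: acts_on_comm dyS y1 hS.
have c2 : GRing.comm (o2 y) (hloc m x) by apply: acts_on_comm dyS y2 hS.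
have hE c : GRing.comm (o1 y + c *: o2 y) (hloc m x).
  (* A zero second coefficient turns the combination on the right into [hloc m x] alone. *)
  have := comm_ladder_site c (0 : K) c1 c1 c2 c2.
  by rewrite scale0r addr0.
by split; [exact: hE | rewrite lowerE; exact: hE].
Qed.

Lemma hloc_norm_ge0 : 0 <= h0.
Proof. by have [] := hloc_local site0. Qed.

Lemma order2_ge : q0 * V ^+ 2 <= rdot Phi (O2 * O2 *m Phi).
Proof.
have [_ _ _ _ [_ [_ ge2]]] := hm L_even.
by have := expval_density_ge _ ge2; rewrite volumeE; apply.
Qed.

Lemma order1_ge : q0 * V ^+ 2 <= rdot Phi (O1 * O1 *m Phi).
Proof.
have [_ _ _ _ [_ [eq12 ge2]]] := hm L_even.
have ge1 := ge2; rewrite -eq12 in ge1.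
by have := expval_density_ge _ ge1; rewrite volumeE; apply.
Qed.

Lemma hermitian_order :
  selfadjoint O1 /\ selfadjoint O2.
Proof.
have [_ _ [osa _ _ _ _] _ _] := hm L_even.
by rewrite /selfadjoint /O1 /O2 /order1 /order2 !linear_sum /= !map_mx_sum;
  split; apply: eq_bigr => x _; have [] := osa x.
Qed.

Lemma lower_adj : B = A^t*.
Proof.
by have [? ?] := hermitian_order; rewrite sum_raise sum_lower adj_ladder.
Qed.

Lemma commutators : [/\ A * B - B * A = C *+ 2, C * A - A * C = A,
  C * B - B * C = - B & C *m H = H *m C].
Proof.
have [_ [_ Ch _ _] [_ _ OC1 OC2 O12] _ _] := hm L_even.
split.
- by rewrite sum_raise sum_lower; apply: comm_ladder.
- by rewrite sum_raise; apply: comm_charge_raise.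
- by rewrite sum_lower; apply: comm_charge_lower.
rewrite mulmx_sumr mulmx_suml; apply: eq_bigr => x _.
by apply/eqP; rewrite -subr_eq0; apply/eqP/Ch.
Qed.

(** The squared norms are the expectations of O1^2 + O2^2 - C and O1^2 + O2^2 + C; each square
    contributes at least q0 V^2. *)
Lemma raise_lower_norm :
  2 * (q0 * V ^+ 2) - Mgs m L <= rdot (A *m Phi) (A *m Phi) /\
  2 * (q0 * V ^+ 2) + Mgs m L <= rdot (B *m Phi) (B *m Phi).
Proof.
have [_ _ [_ _ OC1 OC2 O12] _ [[_ gs1 _ _ CPhi] _]] := hm L_even.
have Phi1 : rdot Phi Phi = 1 by rewrite /rdot gs1.
have -> : rdot (A *m Phi) (A *m Phi) = rdot Phi (B * A *m Phi).
  by rewrite mulv lower_adj rdotC -rdot_adj rdotC.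
have -> : rdot (B *m Phi) (B *m Phi) = rdot Phi (A * B *m Phi).
  by rewrite mulv lower_adj rdot_adj.
have -> : B * A = O1 * O1 + O2 * O2 - C.
  by rewrite sum_raise sum_lower; apply: lower_raise.
have -> : A * B = O1 * O1 + O2 * O2 + C.
  by rewrite sum_raise sum_lower; apply: raise_lower.
rewrite mulmxBl !mulmxDl rdotBr !rdotDr CPhi rdotZr Phi1 mulr1.
rewrite mulr_natl mulr2n.
by split; rewrite lerD2r; exact: (lerD order1_ge order2_ge).
Qed.

Lemma model_eigenvector (M : int) : M != 0 ->
  `|M%:~R| <= max_charge o0 q0 zeta * Num.sqrt V ->
  exists Psi E, [/\ eigenvec H E Psi, C *m Psi = (Mgs m L + M%:~R)%:C *: Psi,
    E <= Egs m L + cubic_const o0 h0 q0 zeta * `|M%:~R| ^+ 3 / V &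
    Mgs m L = 0 ->
      E <= Egs m L + quadratic_const o0 h0 q0 zeta * M%:~R ^+ 2 / V].
Proof.
have [[Hsa _] _ _ _ [[low gs1 HPhi _ CPhi] _]] := hm L_even.
have Phi1 : rdot Phi Phi = 1 by rewrite /rdot gs1.
have [cAB cCA cCB CH] := commutators.
have [ordA ordB] := raise_lower_norm.
have h0_ge0 := hloc_norm_ge0.
case: M => [[|k]|k] //= _.
  rewrite ger0_norm ?ler0n // => Mle.
  exact: (sector_eigenvector lower_adj cAB cCA cCB CPhi Phi1 Hsa low HPhi CH
    raise_bounded lower_bounded comm_raise comm_raise_lower comm_lower
    order_norm_ge0 hloc_local h0_ge0 q0_gt0 V_gt0 ordA (ltn0Sn k) Mle).
(* For negative charge [lower] climbs the tower, with charge [- C] and ground state value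
   [- Mgs m L]. *)
have -> : (Negz k)%:~R = - k.+1%:R :> R by [].
rewrite normrN ger0_norm ?ler0n // sqrrN => Mle.
have AB : A = B^t* by rewrite lower_adj trmxCK.
have cBA : B * A - A * B = (- C) *+ 2 by rewrite -opprB cAB mulNrn.
have cCB' : - C * B - B * - C = B by rewrite mulNr mulrN -opprD cCB opprK.
have cCA' : - C * A - A * - C = - A by rewrite mulNr mulrN -opprD cCA.
have CPhi' : - C *m Phi = ((- Mgs m L)%:C : K) *: Phi.
  by rewrite mulNmx CPhi -scaleNr rmorphN.
have CH' : - C *m H = H *m (- C) by rewrite mulNmx CH mulmxN.
have hl' x : local_op (@vnorm R N) lower raise zeta h0 (hloc m x).
  have [r0 rP [S Sz SP]] := hloc_local x; split=> //; exists S => // y /SP[].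
  by [].
have comm_lr x y : x != y -> GRing.comm (lower x) (raise y).
  by move=> xy; apply/commr_sym/comm_raise_lower; rewrite eq_sym.
have ordB' : 2 * (q0 * V ^+ 2) - - Mgs m L <= rdot (B *m Phi) (B *m Phi).
  by rewrite opprK.
have [Psi [E [HE CE E3 E2]]] := sector_eigenvector AB cBA cCB' cCA' CPhi' Phi1
  Hsa low HPhi CH' lower_bounded raise_bounded comm_lower comm_lr comm_raise
  order_norm_ge0 hl' h0_ge0 q0_gt0 V_gt0 ordB' (ltn0Sn k) Mle.
exists Psi, E; split=> //; last by move=> mu0; apply: E2; rewrite mu0 oppr0.
apply: oppr_inj; rewrite -mulNmx CE -scaleNr -rmorphN; congr (_%:C *: _).
by rewrite opprD opprK.
Qed.
End Model.

Theorem corollary3p2 (R : realType) (o0 h0 : R) (zeta : nat) (q0 : R)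
    (hq0 : 0 < q0) :
  exists C1 C2 C3 : R,
    [/\ 0 < C1, 0 < C2 & 0 < C3] /\
    forall (d n : nat) (hd : (1 <= d)%N) (a : R) (ha : 0 < a)
      (m : model R d n) (hm : standing_assumptions m a o0 h0 zeta q0)
      (L : nat) (hL : even_size L) (M : int) (hM0 : M != 0)
      (hM : `|M%:~R| <= C1 * Num.sqrt (volume R d L)),
    exists (Psi : ket R (site d L) n) (E : R),
      [/\ eigenvec (hamiltonian m L) E Psi,
          charge m L *m Psi = (Mgs m L + M%:~R)%:C *: Psi,
          Egs m L < E,
          E <= Egs m L + C3 * `|M%:~R| ^+ 3 / volume R d L &
          Mgs m L = 0 ->
            E <= Egs m L + C2 * M%:~R ^+ 2 / volume R d L].
Proof.
(* The constants precede any model, and [o0] and [h0] are known to be nonnegative only once a model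
   is given; hence the absolute values. *)
exists (max_charge `|o0| q0 zeta), (quadratic_const `|o0| `|h0| q0 zeta),
  (cubic_const `|o0| `|h0| q0 zeta).
split.
  by split; rewrite ?max_charge_gt0 ?quadratic_const_gt0 ?cubic_const_gt0.
move=> d n _ a _ m hm L hL M M0.
rewrite volumeE // (ger0_norm (order_norm_ge0 hL hm)).
rewrite (ger0_norm (hloc_norm_ge0 hL hm)) => Mle.
have [Psi [E [HE CE E3 E2]]] := model_eigenvector hq0 hL hm M0 Mle.
exists Psi, E; split=> //.
have [_ _ _ _ [[[_ low] _ _ uniq CPhi] _]] := hm L hL.
(* Strictness: if [E] were the ground state energy, uniqueness would make [Psi] a multiple of the
   ground state, of charge [Mgs m L], forcing M = 0. *)
rewrite lt_neqAle (low _ _ HE) andbT; apply: contra_neq M0 => EE.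
have [Psi0 HPsi] := HE; rewrite -EE in HPsi.
have [c Psic] := uniq _ HPsi.
move: CE; rewrite {1}Psic -scalemxAr CPhi scalerA mulrC -scalerA -Psic => /eqP.
rewrite -subr_eq0 -scalerBl scaler_eq0 (negPf Psi0) orbF -rmorphB.
rewrite opprD addrA subrr sub0r => /eqP /(congr1 (@complex.Re R)) /= /eqP.
by rewrite oppr_eq0 intr_eq0 => /eqP.
Qed.
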